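(* Consider Morse polynomials of degree 4 whose degree-4 homogeneous part is non-degenerate and vanishes on exactly two distinct real lines in $\mathbb R^2$. For such a polynomial let $M$ be the number of its critical points in $\mathbb R^2$ and $m_+$ the number of its local maxima. Then the set of pairs $(M,m_+)$ realized by such polynomials is exactly the set of pairs with $M\in\{1,3,5,7,9\}$ and $0\le m_+<M/2$.
   Context: A homogeneous polynomial of degree 4 in $(x,y)$ with real coefficients is called non-degenerate if it is a product of four pairwise non-proportional linear forms over $\mathbb C$. A Morse polynomial of degree 4 is a real polynomial $\mathbb R^2\to\mathbb R$ of degree 4 with non-degenerate degree-4 homogeneous part, all of whose critical points in $\mathbb C^2$ are non-degenerate (there are then exactly 9 of them in $\mathbb C^2$). *)

(* Defs.v *)
From mathcomp Require Import all_boot all_order all_algebra.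
From mathcomp Require Import reals complex.
Set Implicit Arguments. Unset Strict Implicit. Unset Printing Implicit Defensive.
Import Order.TTheory GRing.Theory Num.Theory.
Local Open Scope ring_scope.

(* A polynomial of degree <= 4 in (x,y) with coefficients in F:
   c i j is the coefficient of x^i y^j; only i + j <= 4 is used. *)
Definition coefs4 (F : Type) := 'I_5 -> 'I_5 -> F.

Section Eval.
Variable F : comPzRingType.
Variable c : coefs4 F.

Definition peval (x y : F) : F :=
  \sum_(i < 5) \sum_(j < 5 | (i + j <= 4)%N) c i j * x ^+ i * y ^+ j.

Definition ptop (x y : F) : F :=
  \sum_(i < 5) \sum_(j < 5 | (i + j == 4)%N) c i j * x ^+ i * y ^+ j.

Definition pdx (x y : F) : F :=
  \sum_(i < 5) \sum_(j < 5 | (i + j <= 4)%N)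
     c i j * i%:R * x ^+ i.-1 * y ^+ j.
Definition pdy (x y : F) : F :=
  \sum_(i < 5) \sum_(j < 5 | (i + j <= 4)%N)
     c i j * j%:R * x ^+ i * y ^+ j.-1.
Definition pdxx (x y : F) : F :=
  \sum_(i < 5) \sum_(j < 5 | (i + j <= 4)%N)
     c i j * (i * i.-1)%:R * x ^+ i.-2 * y ^+ j.
Definition pdyy (x y : F) : F :=
  \sum_(i < 5) \sum_(j < 5 | (i + j <= 4)%N)
     c i j * (j * j.-1)%:R * x ^+ i * y ^+ j.-2.
Definition pdxy (x y : F) : F :=
  \sum_(i < 5) \sum_(j < 5 | (i + j <= 4)%N)
     c i j * (i * j)%:R * x ^+ i.-1 * y ^+ j.-1.

Definition is_crit (x y : F) : Prop := pdx x y = 0 /\ pdy x y = 0.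

Definition hess_det (x y : F) : F := pdxx x y * pdyy x y - pdxy x y ^+ 2.
End Eval.

Local Open Scope complex_scope.

Section Real.
Variable R : realType.

Definition cplx (c : coefs4 R) : coefs4 R[i] := fun i j => (c i j)%:C.

Definition nondegenerate_top (c : coefs4 R) : Prop :=
  exists a b : 'I_4 -> R[i],
    (forall k l : 'I_4, k != l -> a k * b l - a l * b k != 0) /\
    (forall x y : R[i], ptop (cplx c) x y = \prod_(k < 4) (a k * x + b k * y)).

Definition morse4 (c : coefs4 R) : Prop :=
  nondegenerate_top c /\
  (forall x y : R[i], is_crit (cplx c) x y -> hess_det (cplx c) x y != 0).

Definition top_two_real_lines (c : coefs4 R) : Prop :=
  exists u v : R * R,
    u.1 * v.2 - u.2 * v.1 != 0 /\
    (forall x y : R, ptop c x y = 0 <->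
       (x * u.2 - y * u.1 = 0 \/ x * v.2 - y * v.1 = 0)).

Definition local_max (c : coefs4 R) (z : R * R) : Prop :=
  exists e : R, 0 < e /\
    forall w : R * R, (w.1 - z.1) ^+ 2 + (w.2 - z.2) ^+ 2 < e ->
      peval c w.1 w.2 <= peval c z.1 z.2.

Definition num_real_crit (c : coefs4 R) (M : nat) : Prop :=
  exists s : seq (R * R), uniq s /\ size s = M /\
    forall z : R * R, z \in s <-> is_crit c z.1 z.2.

Definition num_local_max (c : coefs4 R) (m : nat) : Prop :=
  exists s : seq (R * R), uniq s /\ size s = m /\
    forall z : R * R, z \in s <-> local_max c z.
End Real.

(* Main.v *)
Require Import Defs.
From HB Require Import structures.
From mathcomp Require Import all_boot all_order all_algebra.
From mathcomp Require Import reals complex.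
From mathcomp Require Import ring lra.
Set Implicit Arguments. Unset Strict Implicit. Unset Printing Implicit Defensive.
Import Order.TTheory GRing.Theory Num.Theory.
Local Open Scope ring_scope.

(* A linear change of variables brings the top form to A (x^4 + 2 t x^2 y^2 - y^4), so that the critical points are the common zeros of two monic cubics. The quotient algebra has dimension 9, with the monomials x^i y^j (i, j <= 2) as a basis, and the zeros are simple; hence there are exactly 9 of them, 9 - 2 k of which are real.
   Let J be the Bezoutian on the diagonal, a negative multiple of the Hessian determinant. If weights xi on the zeros are such that L(f) = sum xi f vanishes on 1, x, y and x^2 - y^2, then sum J xi^2 = 2 L(x^2)^2 + (1 + t^2) L(x y)^2 >= 0. Had more than four zeros been real with J < 0 or in the upper half of a conjugate pair, such weights could be chosen conjugation invariant, nonzero and with J xi^2 <= 0 everywhere, a contradiction. So at most 4 - k critical points have a positive Hessian determinant, and local maxima are among them.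
   The pairs are realized by quartics even in y and one further quartic with four maxima, using f and - f. *)

(** * The Bezoutian and the quotient algebra *)

(** In the normal form the leading forms of the two cubics are x^3 + t x y^2 and y^3 - t x^2 y.
    Elimination between them divides by 1 + t^2 only, which is nonzero because t is real. The zeros
    are counted by linear algebra. The Bezoutian is a polynomial in two points that vanishes at two
    distinct zeros and is the Jacobian on the diagonal. On the set of zeros it is therefore an
    invertible diagonal matrix, yet it factors through the nine basis monomials, so there are at
    most 9 zeros. The Bezoutian also supplies a further zero whenever fewer are known. The same
    diagonality turns sum J xi^2 into a double sum of xi(z) xi(w) times the Bezoutian at (z, w), a
    quadratic expression in the moments L(x^i y^j). The Bezoutian has total degree 4, so once L
    kills 1, x and y only its part of degree 2 in each point contributes. The condition on x^2 - y^2
    makes that part positive semidefinite. These four conditions are the source of the bound 4, and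
    2 (4 - k) < 9 - 2 k is the strict inequality of the theorem. *)

Section Bezout.
Variable F : comPzRingType.
Variables (t : F) (a b : nat -> F).

(* [bcub1], [bcub2] are the normalised partial derivatives; the lower order coefficients are listed in the order 1, x, y, x^2, xy, y^2. *)
Definition bcub1 (x y : F) : F :=
  x ^+ 3 + t * x * y ^+ 2 + a 3 * x ^+ 2 + a 4 * x * y + a 5 * y ^+ 2
  + a 1 * x + a 2 * y + a 0.
Definition bcub2 (x y : F) : F :=
  y ^+ 3 - t * x ^+ 2 * y + b 3 * x ^+ 2 + b 4 * x * y + b 5 * y ^+ 2
  + b 1 * x + b 2 * y + b 0.

(** Divided differences along two different paths from (x, y) to (u, v): through (u, y) for the
    first cubic and through (x, v) for the second. This crossing keeps the degrees of the
    determinant in u and in v at most 2, so that it expands in the nine basis monomials. On the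
    diagonal the four entries are the partial derivatives. *)
Definition bez11 (x y u v : F) : F :=
  x ^+ 2 + x * u + u ^+ 2 + t * y ^+ 2 + a 3 * (x + u) + a 4 * y + a 1.
Definition bez12 (x y u v : F) : F :=
  t * u * (y + v) + a 4 * u + a 5 * (y + v) + a 2.
Definition bez21 (x y u v : F) : F :=
  - t * (x + u) * v + b 3 * (x + u) + b 4 * v + b 1.
Definition bez22 (x y u v : F) : F :=
  y ^+ 2 + y * v + v ^+ 2 - t * x ^+ 2 + b 4 * x + b 5 * (y + v) + b 2.
Definition bezoutian (x y u v : F) : F :=
  bez11 x y u v * bez22 x y u v - bez12 x y u v * bez21 x y u v.

(** Cramer's rule for the 2 x 2 system that expresses the differences of the two cubics through x -
    u and y - v. *)
Lemma bezoutian_mul1 (x y u v : F) :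
  (x - u) * bezoutian x y u v =
  bez22 x y u v * (bcub1 x y - bcub1 u v) - bez12 x y u v * (bcub2 x y - bcub2 u v).
Proof. rewrite /bezoutian /bez11 /bez12 /bez21 /bez22 /bcub1 /bcub2; ring. Qed.

Lemma bezoutian_mul2 (x y u v : F) :
  (y - v) * bezoutian x y u v =
  bez11 x y u v * (bcub2 x y - bcub2 u v) - bez21 x y u v * (bcub1 x y - bcub1 u v).
Proof. rewrite /bezoutian /bez11 /bez12 /bez21 /bez22 /bcub1 /bcub2; ring. Qed.

Definition monom9 (x y : F) (k : nat) : F := x ^+ (k %% 3) * y ^+ (k %/ 3).

(** As polynomials in u and v, the entries are u^2 + al1 u + al0, t u v + ga1 u + a5 v + ga0, - t u
    v + b3 u + de1 v + de0 and v^2 + be1 v + be0; the list collects the coefficients of their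
    determinant. *)
Definition bez_coef (x y : F) : seq F :=
  let al1 := x + a 3 in let al0 := x ^+ 2 + t * y ^+ 2 + a 3 * x + a 4 * y + a 1 in
  let be1 := y + b 5 in let be0 := y ^+ 2 - t * x ^+ 2 + b 4 * x + b 5 * y + b 2 in
  let ga1 := t * y + a 4 in let ga0 := a 5 * y + a 2 in
  let de1 := - t * x + b 4 in let de0 := b 3 * x + b 1 in
  [:: al0 * be0 - ga0 * de0; al1 * be0 - (ga1 * de0 + ga0 * b 3); be0 - ga1 * b 3;
      al0 * be1 - (a 5 * de0 + ga0 * de1);
      al1 * be1 - (t * de0 + ga1 * de1 + a 5 * b 3 - t * ga0);
      be1 - (t * b 3 - t * ga1);
      al0 - a 5 * de1; al1 - (t * de1 - t * a 5); 1 + t ^+ 2].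

Lemma bezoutianE (x y u v : F) :
  bezoutian x y u v = \sum_(k < 9) (bez_coef x y)`_k * monom9 u v k.
Proof.
rewrite !big_ord_recl big_ord0 /= /bump /= /monom9 /=.
rewrite /bezoutian /bez11 /bez12 /bez21 /bez22; ring.
Qed.
End Bezout.

(** * Multiplication matrices of the quotient algebra *)

Section QuotientAlgebra.
Variable F : fieldType.
Variables (t : F) (a b : nat -> F).
Hypothesis t_neq : 1 + t ^+ 2 != 0.
Let n := (1 + t ^+ 2)^-1.
Let nE : n * t ^+ 2 = 1 - n.
Proof. by have := mulVf t_neq; rewrite -/n mulrDr mulr1 addrC => <-; ring. Qed.

(* Normal forms of x^3, y^3, x^3 y, x y^3, x^3 y^2, x^2 y^3 modulo the two cubics in the basis x^i y^j (i, j <= 2), ordered by [3 * j + i]. *)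
Let rx3 : seq F := [:: - a 0; - a 1; - a 3; - a 2; - a 4; 0; - a 5; - t; 0].
Let ry3 : seq F := [:: - b 0; - b 1; - b 3; - b 2; - b 4; t; - b 5; 0; 0].
(** The products y p and x q of the cubics p and q involve both x^3 y and x y^3; solving for these
    two monomials means inverting a 2 x 2 system of determinant 1 + t^2, hence the factor [n]. *)
Let rx3y : seq F := [seq n * z | z <- [::
  - t * a 0 * b 3 + a 5 * b 0;
  - t * a 1 * b 3 + t * b 0 + a 5 * b 1;
  - t * a 3 * b 3 + t * b 1 + a 5 * b 3;
  - t * a 2 * b 3 + a 5 * b 2 - a 0;
  - t * a 4 * b 3 + t * b 2 + a 5 * b 4 - a 1;
  - t * a 5 + t * b 4 - a 3;
  - t * a 5 * b 3 + a 5 * b 5 - a 2;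
  - t * t * b 3 + t * b 5 - a 4; 0]].
Let rxy3 : seq F := [seq n * z | z <- [::
  t * a 5 * b 0 + a 0 * b 3;
  t * a 5 * b 1 + a 1 * b 3 - b 0;
  t * a 5 * b 3 + a 3 * b 3 - b 1;
  t * a 5 * b 2 - t * a 0 + a 2 * b 3;
  t * a 5 * b 4 - t * a 1 + a 4 * b 3 - b 2;
  - t * t * a 5 - t * a 3 - b 4;
  t * a 5 * b 5 - t * a 2 + a 5 * b 3;
  - t * a 4 + t * b 3 - b 5; 0]].
Let e9 (k : nat) : seq F := mkseq (fun j => (j == k)%:R) 9.
(** Obtained as y times x^3 y: multiplication by y shifts indices by 3, and the entries 6 and 7
    overflow into y^3 and x y^3. Entry 8 of [rx3y] is zero, so x^2 y^3 does not appear. The next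
    list is x times x y^3, with overflow from the entries 2 and 5. *)
Let rx3y2 : seq F :=
  mkseq (fun j => (if (3 <= j)%N then rx3y`_(j - 3) else 0)
                  + rx3y`_6 * ry3`_j + rx3y`_7 * rxy3`_j) 9.
Let rx2y3 : seq F :=
  mkseq (fun j => (if (j %% 3 != 0)%N then rxy3`_(j - 1) else 0)
                  + rxy3`_2 * rx3`_j + rxy3`_5 * rx3y`_j) 9.
Let tblX := [:: e9 1; e9 2; rx3; e9 4; e9 5; rx3y; e9 7; e9 8; rx3y2].
Let tblY := [:: e9 3; e9 4; e9 5; e9 6; e9 7; e9 8; ry3; rxy3; rx2y3].
Let mx9 (s : seq (seq F)) : 'M[F]_9 := \matrix_(i, j) (nth [::] s i)`_j.

(** Row k is the normal form of x times the k-th monomial: algebra elements are row vectors, and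
    multiplication acts on the right. *)
Definition mulXmx : 'M[F]_9 := mx9 tblX.
Definition mulYmx : 'M[F]_9 := mx9 tblY.

Let mx9_mulE s1 s2 (i j : 'I_9) :
  (mx9 s1 *m mx9 s2) i j =
  foldr +%R 0 [seq (nth [::] s1 i)`_k * (nth [::] s2 k)`_j | k <- iota 0 9].
Proof.
rewrite mxE foldrE big_map -[iota 0 9]/(index_iota 0 9) big_mkord.
by apply: eq_bigr => k _; rewrite !mxE.
Qed.

(** This is the consistency check for the table of normal forms: commuting matrices define an action
    of the polynomial ring on a space of dimension 9. All 81 entries are compared, with [nE] as the
    rewriting rule for [n]. *)
Lemma mulXYmxC : mulXmx *m mulYmx = mulYmx *m mulXmx.
Proof.
apply/matrixP => i j; rewrite !mx9_mulE.
have [li lj] := (ltn_ord i, ltn_ord j).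
case: i j li lj => [i _] [j _] /= li lj.
do 9 (case: i li => [_|i li]; [
do 9 (case: j lj => [_|j lj]; [rewrite /= ?/subn /=; try by ring: nE|]); by []|]); by [].
Qed.

Definition poly_xy (c : F) : {poly {poly F}} := c%:P%:P.

Lemma commr_mulY : commr_rmorph (horner_mx mulXmx) mulYmx.
Proof. by move=> p; apply/comm_mx_horner/esym/mulXYmxC. Qed.

(** Substitution of the two matrices: the inner polynomial variable stands for x and the outer one
    for y. *)
Definition ev9 : {poly {poly F}} -> 'M[F]_9 := horner_morph commr_mulY.
HB.instance Definition _ := GRing.RMorphism.on ev9.

Lemma ev9C c : ev9 (poly_xy c) = c%:M.
Proof. by rewrite /ev9 horner_morphC /= horner_mx_C. Qed.
Lemma ev9X : ev9 'X%:P = mulXmx.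
Proof. by rewrite /ev9 horner_morphC /= horner_mx_X. Qed.
Lemma ev9Y : ev9 'X = mulYmx.
Proof. by rewrite /ev9 horner_morphX. Qed.

Lemma ev9M p q : ev9 (p * q) = ev9 p *m ev9 q.
Proof. exact: rmorphM. Qed.
Lemma ev9B p q : ev9 (p - q) = ev9 p - ev9 q.
Proof. exact: rmorphB. Qed.

Lemma ev9_comm p q : ev9 p *m ev9 q = ev9 q *m ev9 p.
Proof. by rewrite -![_ *m _]/(_ * _) -!rmorphM mulrC. Qed.

Let d (k : nat) : 'rV[F]_9 := delta_mx 0 (inord k).
Let dE k s : (k < 9)%N -> d k *m mx9 s = \row_j (nth [::] s k)`_j.
Proof.
move=> lk; rewrite -rowE; apply/rowP => j; rewrite !mxE inordK //.
Qed.
Let rowe k : (k < 9)%N -> \row_j (e9 k)`_j = d k.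
Proof.
move=> lk; apply/rowP => j; rewrite !mxE nth_mkseq //= ; congr (_%:R).
by rewrite -val_eqE /= inordK.
Qed.

(** The unit, basis vector 0, is cyclic: applying [ev9 p] to it gives the normal form of p. *)
Lemma ev9_monom9 k : (k < 9)%N ->
  delta_mx 0 (inord 0) *m ev9 (monom9 'X%:P 'X k) = delta_mx 0 (inord k) :> 'rV_9.
Proof.
rewrite -/(d 0) -/(d k).
have X1 i : (i.+1 < 9)%N -> (i \in [:: 0; 1; 3; 4; 6; 7])%N -> d i *m mulXmx = d i.+1.
  move=> li Hi; rewrite dE ?(ltnW li) // -rowe //.
  by move: Hi; rewrite !inE => /or4P [/eqP->|/eqP->|/eqP->|/or3P[/eqP->|/eqP->|/eqP->]].
have Y1 i : (i < 6)%N -> d i *m mulYmx = d i.+3.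
  move=> li; rewrite dE ?(ltn_trans li) // -rowe //.
  by case: i li => [|[|[|[|[|[|]]]]]].
rewrite /monom9 !rmorphM !rmorphXn /= ev9X ev9Y -[_ * _]/(_ *m _) mulmxA.
have {}X1 i : (i < 3)%N -> d 0 *m mulXmx ^+ i = d i.
  case: i => [|[|[|]]] // _; first by rewrite expr0 mulmx1.
    by rewrite expr1 X1.
  by rewrite expr2 -[_ * _]/(_ *m _) mulmxA !X1.
move=> lk; rewrite X1 ?ltn_mod //.
case: k lk => [|[|[|[|[|[|[|[|[|]]]]]]]]] // _;
  rewrite /= ?expr0 ?expr1 ?expr2 ?mulmx1 // -?[_ * _]/(_ *m _) ?mulmxA ?Y1 //.
Qed.

Let tp := poly_xy t.
Let ap k := poly_xy (a k).
Let bp k := poly_xy (b k).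

(** Every basis vector is the unit times a monomial, and that monomial commutes with p. Hence
    vanishing in the quotient needs to be tested on one row only. *)
Let ev9_eq0 p : d 0 *m ev9 p = 0 -> ev9 p = 0.
Proof.
move=> p0; apply/row_matrixP => i; rewrite row0 rowE.
have -> : delta_mx 0 i = delta_mx 0 (inord i) :> 'rV_9 by rewrite inord_val.
rewrite -ev9_monom9 // -mulmxA ev9_comm mulmxA p0 mul0mx.
by [].
Qed.

Lemma ev9_bcub1 : ev9 (bcub1 tp ap 'X%:P 'X) = 0.
Proof.
apply: ev9_eq0.
have -> : bcub1 tp ap 'X%:P 'X = monom9 'X%:P 'X 2 * 'X%:P + tp * monom9 'X%:P 'X 7
  + ap 3 * monom9 'X%:P 'X 2 + ap 4 * monom9 'X%:P 'X 4 + ap 5 * monom9 'X%:P 'X 6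
  + ap 1 * monom9 'X%:P 'X 1 + ap 2 * monom9 'X%:P 'X 3 + ap 0 * monom9 'X%:P 'X 0.
  rewrite /bcub1 /monom9 /=; ring.
move: ev9_monom9; move: (monom9 'X%:P 'X) => m mE.
rewrite !rmorphD !rmorphM /= !ev9C ev9X -![_ * _]/(_ *m _) !mul_scalar_mx.
rewrite !mulmxDr -!scalemxAr mulmxA !mE // dE //.
apply/rowP => j; rewrite !mxE -!val_eqE /= !inordK //.
have lj := ltn_ord j; case: j lj => [j _] /= lj.
do 9 (case: j lj => [_|j lj]; [by rewrite /=; ring|]); by [].
Qed.

Lemma ev9_bcub2 : ev9 (bcub2 tp bp 'X%:P 'X) = 0.
Proof.
apply: ev9_eq0.
have -> : bcub2 tp bp 'X%:P 'X = monom9 'X%:P 'X 6 * 'X - tp * monom9 'X%:P 'X 5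
  + bp 3 * monom9 'X%:P 'X 2 + bp 4 * monom9 'X%:P 'X 4 + bp 5 * monom9 'X%:P 'X 6
  + bp 1 * monom9 'X%:P 'X 1 + bp 2 * monom9 'X%:P 'X 3 + bp 0 * monom9 'X%:P 'X 0.
  rewrite /bcub2 /monom9 /=; ring.
move: ev9_monom9; move: (monom9 'X%:P 'X) => m mE.
rewrite !rmorphD !rmorphN !rmorphM /= !ev9C ev9Y -![_ * _]/(_ *m _) !mul_scalar_mx.
rewrite !mulmxDr !mulmxN -!scalemxAr mulmxA !mE // dE //.
apply/rowP => j; rewrite !mxE -!val_eqE /= !inordK //.
have lj := ltn_ord j; case: j lj => [j _] /= lj.
do 9 (case: j lj => [_|j lj]; [by rewrite /=; ring|]); by [].
Qed.

Lemma ev9_eigen (h : 'rV[F]_9) u v p :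
  h *m mulXmx = u *: h -> h *m mulYmx = v *: h ->
  h *m ev9 p = p.[v%:P].[u] *: h.
Proof.
move=> hX hY.
have hp (q : {poly F}) : h *m horner_mx mulXmx q = q.[u] *: h.
  elim/poly_ind: q => [|q c IH]; first by rewrite rmorph0 mulmx0 horner0 scale0r.
  rewrite rmorphD rmorphM /= horner_mx_X horner_mx_C -[_ * _]/(_ *m _) mulmxDr mulmxA IH.
  by rewrite -scalemxAl hX scalerA mul_mx_scalar -scalerDl !hornerE.
elim/poly_ind: p => [|p c IH]; first by rewrite rmorph0 mulmx0 horner0 horner0 scale0r.
rewrite rmorphD rmorphM /= ev9Y -[_ * _]/(_ *m _) mulmxDr mulmxA IH.
rewrite -scalemxAl hY scalerA /ev9 horner_morphC /= hp -scalerDl.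
by rewrite hornerMXaddC !hornerE.
Qed.

Section Column.
Variables x y : F.
Hypotheses (p0 : bcub1 t a x y = 0) (q0 : bcub2 t b x y = 0).
Let dot (s : seq F) := \sum_(k < 9) s`_k * monom9 x y k.

Let dot_x3 : dot rx3 = x ^+ 3.
Proof.
rewrite /dot !big_ord_recl !big_ord0 /= /bump /= /monom9 /=.
by transitivity (x ^+ 3 - bcub1 t a x y); [rewrite /bcub1; ring|rewrite p0 subr0].
Qed.

Let dot_y3 : dot ry3 = y ^+ 3.
Proof.
rewrite /dot !big_ord_recl !big_ord0 /= /bump /= /monom9 /=.
by transitivity (y ^+ 3 - bcub2 t b x y); [rewrite /bcub2; ring|rewrite q0 subr0].
Qed.

Let dot_x3y : dot rx3y = x ^+ 3 * y.
Proof.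
rewrite /dot !big_ord_recl !big_ord0 /= /bump /= /monom9 /=.
(* The combination y p - t x q removes x y^3; the two further multiples remove the terms a5 y^3 and
   - t b3 x^3 that it leaves outside the basis. *)
transitivity (x ^+ 3 * y - n * (y * bcub1 t a x y - t * x * bcub2 t b x y
  - a 5 * bcub2 t b x y + t * b 3 * bcub1 t a x y)); last by rewrite p0 q0; ring.
rewrite /bcub1 /bcub2; ring: nE.
Qed.

Let dot_xy3 : dot rxy3 = x * y ^+ 3.
Proof.
rewrite /dot !big_ord_recl !big_ord0 /= /bump /= /monom9 /=.
transitivity (x * y ^+ 3 - n * (t * y * bcub1 t a x y + x * bcub2 t b x y
  - t * a 5 * bcub2 t b x y - b 3 * bcub1 t a x y)); last by rewrite p0 q0; ring.
rewrite /bcub1 /bcub2; ring: nE.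
Qed.

Let dot_e9 k : (k < 9)%N -> dot (e9 k) = monom9 x y k.
Proof.
move=> lk; rewrite /dot (bigD1 (Ordinal lk)) //= big1 ?addr0 => [|j /negPf jk].
  by rewrite nth_mkseq // eqxx mul1r.
by rewrite nth_mkseq // -(inj_eq val_inj) /= in jk *; rewrite jk mul0r.
Qed.

Let dot_x3y2 : dot rx3y2 = x ^+ 3 * y ^+ 2.
Proof.
have u8 : rx3y`_8 = 0 by rewrite /=; ring.
have -> : x ^+ 3 * y ^+ 2 = y * dot rx3y by rewrite dot_x3y; ring.
have -> : dot rx3y2 = y * dot rx3y + rx3y`_6 * (dot ry3 - y ^+ 3)
                      + rx3y`_7 * (dot rxy3 - x * y ^+ 3).
  move: u8; rewrite /rx3y2; move: rx3y rxy3 ry3 => r1 r2 r3 u8.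
  rewrite /dot !big_ord_recl !big_ord0 /= /bump /= /monom9 /= !subSS !subn0 !addn0 !add1n u8; ring.
by rewrite dot_y3 dot_xy3; ring.
Qed.

Let dot_x2y3 : dot rx2y3 = x ^+ 2 * y ^+ 3.
Proof.
have u8 : rxy3`_8 = 0 by rewrite /=; ring.
have -> : x ^+ 2 * y ^+ 3 = x * dot rxy3 by rewrite dot_xy3; ring.
have -> : dot rx2y3 = x * dot rxy3 + rxy3`_2 * (dot rx3 - x ^+ 3)
                      + rxy3`_5 * (dot rx3y - x ^+ 3 * y).
  move: u8; rewrite /rx2y3; move: rxy3 rx3y rx3 => r1 r2 r3 u8.
  rewrite /dot !big_ord_recl !big_ord0 /= /bump /= /monom9 /= !subSS !subn0 !addn0 !add1n u8; ring.
by rewrite dot_x3 dot_x3y; ring.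
Qed.

Let mx9_col s : mx9 s *m (\col_k monom9 x y k) = \col_k dot (nth [::] s k).
Proof. by apply/colP => i; rewrite !mxE; apply: eq_bigr => k _; rewrite !mxE. Qed.

(** Evaluation at a common zero is a character of the quotient algebra, so it is an eigenvector for
    the dual action on columns. *)
Lemma mulXmx_col : mulXmx *m (\col_k monom9 x y k) = x *: \col_k monom9 x y k.
Proof.
rewrite mx9_col; apply/colP => -[i li]; rewrite !mxE.
do 9 (case: i li => [_|i li] /=;
  [rewrite ?dot_e9 // ?dot_x3 ?dot_x3y ?dot_x3y2 /monom9 /=; ring|]); by [].
Qed.

Lemma mulYmx_col : mulYmx *m (\col_k monom9 x y k) = y *: \col_k monom9 x y k.
Proof.
rewrite mx9_col; apply/colP => -[i li]; rewrite !mxE.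
do 9 (case: i li => [_|i li] /=;
  [rewrite ?dot_e9 // ?dot_y3 ?dot_xy3 ?dot_x2y3 /monom9 /=; ring|]); by [].
Qed.
End Column.

(** A polynomial acts on h as the scalar given by its value at (u, v), whereas both cubics act as
    zero. *)
Lemma eigen_zero (h : 'rV[F]_9) u v : h != 0 ->
  h *m mulXmx = u *: h -> h *m mulYmx = v *: h ->
  bcub1 t a u v = 0 /\ bcub2 t b u v = 0.
Proof.
move=> h0 hX hY.
have E1 := ev9_eigen (bcub1 tp ap 'X%:P 'X) hX hY.
have E2 := ev9_eigen (bcub2 tp bp 'X%:P 'X) hX hY.
move: E1 E2; rewrite ev9_bcub1 ev9_bcub2 mulmx0.
move=> /esym/eqP; rewrite scaler_eq0 (negPf h0) orbF => /eqP E1.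
move=> /esym/eqP; rewrite scaler_eq0 (negPf h0) orbF => /eqP E2.
split; [rewrite -E1 /bcub1|rewrite -E2 /bcub2]; rewrite /tp /ap /bp /poly_xy !hornerE; ring.
Qed.
End QuotientAlgebra.

Section Eigenvectors.
Variable F : fieldType.
Variables (t : F) (a b : nat -> F).
Hypothesis t_neq : 1 + t ^+ 2 != 0.
Let tp := poly_xy t.
Let ap k := poly_xy (a k).
Let bp k := poly_xy (b k).
Local Notation mulXmx := (mulXmx t a b).
Local Notation mulYmx := (mulYmx t a b).
Local Notation ev9 := (ev9 a b t_neq).
Let ev9C := ev9C a b t_neq.
Let ev9X := ev9X a b t_neq.
Let ev9Y := ev9Y a b t_neq.
Let ev9_eigen h u v p hX hY := @ev9_eigen F t a b t_neq h u v p hX hY.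
Let ev9M := @ev9M F t a b t_neq.
Let ev9B := @ev9B F t a b t_neq.
Let ev9_comm := @ev9_comm F t a b t_neq.
Let ev9_bcub1 := ev9_bcub1 a b t_neq.
Let ev9_bcub2 := ev9_bcub2 a b t_neq.

(* A common eigenvector [h] with eigenvalues [u], [v] spans an ideal of the quotient algebra; if [h] vanished at (u, v), then multiplying it by the Bezoutian at (u, v) would give both [J h] and [h(u, v)] times the Bezoutian, so [J h = 0]. *)
Lemma eigen_vanish (h : 'rV[F]_9) u v :
  h *m mulXmx = u *: h -> h *m mulYmx = v *: h ->
  \sum_(k < 9) h 0 k * monom9 u v k = 0 -> bezoutian t a b u v u v *: h = 0.
Proof.
move=> hX hY hz.
have [h0|h0] := eqVneq h 0; first by rewrite h0 scaler0.
have [z1 z2] := eigen_zero t_neq h0 hX hY.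
have [D DE] : exists D, D = bezoutian tp ap bp 'X%:P 'X (poly_xy u) (poly_xy v) by eexists.
have b1 : bcub1 tp ap (poly_xy u) (poly_xy v) = 0.
  transitivity (poly_xy (bcub1 t a u v)); last by rewrite z1 /poly_xy !rmorph0.
  by rewrite /bcub1 /tp /ap /poly_xy !(polyCD, polyCM, polyC_exp).
have b2 : bcub2 tp bp (poly_xy u) (poly_xy v) = 0.
  transitivity (poly_xy (bcub2 t b u v)); last by rewrite z2 /poly_xy !rmorph0.
  by rewrite /bcub2 /tp /bp /poly_xy !(polyCD, polyCN, polyCM, polyC_exp).
(* By the Cramer identities, multiplying D by x - u or y - v lands in the ideal of the two cubics,
   so the rows of [ev9 D] are common eigenvectors for (u, v). *)
have DX : ev9 D *m mulXmx = u *: ev9 D.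
  have : ev9 (('X%:P - poly_xy u) * D) = 0.
    rewrite DE bezoutian_mul1 b1 b2 !subr0 ev9B (ev9M _ (bcub1 _ _ _ _)) (ev9M _ (bcub2 _ _ _ _)).
    by rewrite ev9_bcub1 ev9_bcub2 !mulmx0 subr0.
  rewrite ev9M ev9B ev9C ev9X mulmxBl mul_scalar_mx => /eqP.
  by rewrite subr_eq0 => /eqP <-; have := ev9_comm D 'X%:P; rewrite ev9X.
have DY : ev9 D *m mulYmx = v *: ev9 D.
  have : ev9 (('X - poly_xy v) * D) = 0.
    rewrite DE bezoutian_mul2 b1 b2 !subr0 ev9B (ev9M _ (bcub1 _ _ _ _)) (ev9M _ (bcub2 _ _ _ _)).
    by rewrite ev9_bcub1 ev9_bcub2 !mulmx0 subr0.
  rewrite ev9M ev9B ev9C ev9Y mulmxBl mul_scalar_mx => /eqP.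
  by rewrite subr_eq0 => /eqP <-; have := ev9_comm D 'X; rewrite ev9Y.
pose H : {poly {poly F}} := \sum_(k < 9) poly_xy (h 0 k) * monom9 'X%:P 'X k.
have hH : h = delta_mx 0 (inord 0) *m ev9 H.
  rewrite [LHS]row_sum_delta rmorph_sum mulmx_sumr; apply: eq_bigr => k _.
  by rewrite /= ev9M ev9C mul_scalar_mx -scalemxAr ev9_monom9 // inord_val.
have Dh : h *m ev9 D = bezoutian t a b u v u v *: h.
  rewrite (ev9_eigen D hX hY); congr (_ *: _).
  rewrite DE /bezoutian /bez11 /bez12 /bez21 /bez22 /tp /ap /bp /poly_xy !hornerE; ring.
rewrite -Dh hH -mulmxA ev9_comm mulmxA.
rewrite (ev9_eigen (u := u) (v := v)); last 2 first.
- by rewrite -mulmxA DX -scalemxAr.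
- by rewrite -mulmxA DY -scalemxAr.
rewrite /H !horner_sum (eq_bigr (fun k => h 0 k * monom9 u v k)) ?hz ?scale0r //.
by move=> k _; rewrite /poly_xy /monom9 !(hornerE, horner_exp).
Qed.
End Eigenvectors.

Lemma left_kernel (F : fieldType) m n (V : 'M[F]_(m, n)) : (n < m)%N ->
  exists2 xi : 'rV[F]_m, xi != 0 & xi *m V = 0.
Proof.
move=> lt_nm; have : kermx V != 0.
  rewrite -mxrank_eq0 mxrank_ker -lt0n subn_gt0.
  exact: leq_ltn_trans (rank_leq_col V) lt_nm.
by case/rowV0Pn => xi /sub_kermxP xiV xi0; exists xi.
Qed.

(** * Exactly nine common zeros over a closed field *)

Section NineZeros.
Variable K : numClosedFieldType.
Variables (t : K) (a b : nat -> K).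
Hypothesis t_neq : 1 + t ^+ 2 != 0.

Definition bzero (z : K * K) := (bcub1 t a z.1 z.2 == 0) && (bcub2 t b z.1 z.2 == 0).
Definition bez (z w : K * K) := bezoutian t a b z.1 z.2 w.1 w.2.

Hypothesis simple : forall z, bzero z -> bez z z != 0.

Lemma bez_neq z w : bzero z -> bzero w -> z != w -> bez z w = 0.
Proof.
move=> /andP[/eqP z1 /eqP z2] /andP[/eqP w1 /eqP w2] zw; rewrite /bez.
have := bezoutian_mul1 t a b z.1 z.2 w.1 w.2.
have := bezoutian_mul2 t a b z.1 z.2 w.1 w.2.
rewrite z1 z2 w1 w2 !subr0 !mulr0 !subr0.
move: (bezoutian _ _ _ _ _ _ _) => d /eqP; rewrite mulf_eq0 subr_eq0.
move=> /orP[/eqP e2|/eqP -> //] /eqP; rewrite mulf_eq0 subr_eq0.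
move=> /orP[/eqP e1|/eqP -> //].
by case/eqP: zw; case: z w e1 e2 {z1 z2 w1 w2} => [? ?] [? ?] /= -> ->.
Qed.

(** Weighted sums of the Bezoutian depend on the weights only through nine moments. *)
Lemma bez_sum (T : Type) (r : seq T) (z : K * K) (xi : T -> K) (w : T -> K * K) :
  \sum_(i <- r) xi i * bez z (w i) =
  \sum_(k < 9) (bez_coef t a b z.1 z.2)`_k * \sum_(i <- r) xi i * monom9 (w i).1 (w i).2 k.
Proof.
under [RHS]eq_bigr do rewrite mulr_sumr.
rewrite exchange_big; apply: eq_bigr => i _.
by rewrite /bez bezoutianE mulr_sumr; apply: eq_bigr => k _; rewrite mulrCA.
Qed.

(** More than nine zeros would carry nonzero weights with all nine moments zero. Pairing them with
    the Bezoutian at the i-th zero leaves only the diagonal term, whose Jacobian is nonzero, so each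
    weight vanishes. *)
Lemma size_bzero (s : seq (K * K)) : uniq s -> all bzero s -> (size s <= 9)%N.
Proof.
move=> us /allP sz; rewrite leqNgt; apply/negP => lt9.
pose w (i : 'I_(size s)) := nth (0, 0) s i.
have wz i : bzero (w i) by apply/sz/mem_nth.
have [xi xi0 xiV] :=
  left_kernel (\matrix_(i < size s, k < 9) monom9 (w i).1 (w i).2 k) lt9.
case/eqP: xi0; apply/rowP => i; rewrite mxE.
have := bez_sum (index_enum _) (w i) (fun j => xi 0 j) w.
rewrite [RHS]big1 => [|k _]; last first.
  have := congr1 (fun M : 'rV_9 => M 0 k) xiV; rewrite !mxE => Ek.
  by under eq_bigr => j _ do
    rewrite -[monom9 _ _ _](mxE matrix_key (fun i (k : 'I_9) => monom9 (w i).1 (w i).2 k)); rewrite Ek mulr0.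
rewrite (bigD1 i) //= big1 => [|j ji]; last first.
  by rewrite bez_neq ?mulr0 // /w nth_uniq // eq_sym.
move/eqP; rewrite addr0 mulf_eq0 (negPf (simple (wz i))) orbF => /eqP //.
Qed.

(* The monomial vectors at the zeros in [s] are right eigenvectors of the multiplication matrices, so their left annihilator is stable and contains a common eigenvector; by [eigen_vanish] its eigenvalues form a zero outside [s]. *)
Lemma another_bzero (s : seq (K * K)) : all bzero s -> (size s < 9)%N ->
  exists2 z, bzero z & z \notin s.
Proof.
move=> /allP sz lt9.
pose w (i : 'I_(size s)) := nth (0, 0) s i.
have wz i : bzero (w i) by apply/sz/mem_nth.
pose V := \matrix_(k < 9, i < size s) monom9 (w i).1 (w i).2 k.
have colV i : col i V = \col_k monom9 (w i).1 (w i).2 k by apply/colP => k; rewrite !mxE.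
have XV : mulXmx t a b *m V = V *m diag_mx (\row_i (w i).1).
  apply/matrixP => k i; rewrite mul_mx_diag mxE.
  have /andP[/eqP z1 /eqP z2] := wz i.
  have := congr1 (fun M : 'cV_9 => M k 0) (mulXmx_col t_neq z1 z2).
  by rewrite !mxE mulrC => <-; apply: eq_bigr => j _; rewrite !mxE.
have YV : mulYmx t a b *m V = V *m diag_mx (\row_i (w i).2).
  apply/matrixP => k i; rewrite mul_mx_diag mxE.
  have /andP[/eqP z1 /eqP z2] := wz i.
  have := congr1 (fun M : 'cV_9 => M k 0) (mulYmx_col t_neq z1 z2).
  by rewrite !mxE mulrC => <-; apply: eq_bigr => j _; rewrite !mxE.
pose W := kermx V; pose B := row_base W.
have rB : (0 < \rank W)%N.
  by rewrite mxrank_ker subn_gt0 (leq_ltn_trans (rank_leq_col V)).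
have stab M D : M *m V = V *m D -> (B *m M <= B)%MS.
  move=> MV; rewrite eq_row_base (eqmxMr M (eq_row_base W)); apply/sub_kermxP.
  by rewrite -mulmxA MV mulmxA mulmx_ker mul0mx.
(* The matrix, in the basis [B], of the restriction of M to the stable space [W]. The restrictions
   of the two multiplication matrices commute, so they have a common eigenvector over the closed
   field. *)
pose res M := B *m M *m pinvmx B.
have resB M D : M *m V = V *m D -> res M *m B = B *m M.
  by move=> MV; rewrite /res mulmxKpV // (stab _ _ MV).
have freeB : row_free B by apply: row_base_free.
have XB := resB _ _ XV; have YB := resB _ _ YV.
move: {res resB}(res (mulXmx t a b)) (res (mulYmx t a b)) XB YB => A C XB YB.
have AC : A *m C = C *m A.
  apply: (row_free_inj freeB); rewrite -!mulmxA XB YB 2!mulmxA XB YB.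
  by rewrite -!mulmxA mulXYmxC.
have [v v0 /andP[/sub_rVP[x vX] /sub_rVP[y vY]]] := common_eigenvector2 rB AC.
pose h := v *m B.
have h0 : h != 0 by rewrite mulmx_free_eq0.
have hX : h *m mulXmx t a b = x *: h.
  by rewrite -mulmxA -XB mulmxA vX scalemxAl.
have hY : h *m mulYmx t a b = y *: h.
  by rewrite -mulmxA -YB mulmxA vY scalemxAl.
have hW : (h <= W)%MS by rewrite -(eq_row_base W) submxMl.
move: h h0 hX hY hW => {vX vY v0 v}h h0 hX hY hW.
have [zx zy] := eigen_zero t_neq h0 hX hY.
have zxy : bzero (x, y) by rewrite /bzero zx zy !eqxx.
exists (x, y) => //; apply/negP => /(nthP (0, 0))[i li wi].
have := simple zxy; rewrite /bez /= => /negP; apply.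
have : bezoutian t a b x y x y *: h = 0.
  apply: eigen_vanish (hX) (hY) _ => //.
  have /sub_kermxP hV := hW.
  have := congr1 (fun M : 'rV_(size s) => M 0 (Ordinal li)) hV; rewrite !mxE => E; rewrite -[RHS]E {E}.
  by apply: eq_bigr => k _; rewrite !mxE /w /= wi.
by move/eqP; rewrite scaler_eq0 (negPf h0) orbF.
Qed.

Lemma nine_bzeros : exists s : seq (K * K),
  [/\ uniq s, size s = 9%N & forall z, (z \in s) = bzero z].
Proof.
have H n : (n <= 9)%N -> exists s : seq (K * K), [/\ uniq s, size s = n & all bzero s].
  elim: n => [|n IH] ln; first by exists [::].
  have [s [us ss sz]] := IH (ltnW ln).
  have [|z zz zs] := another_bzero sz; first by rewrite ss.
  by exists (z :: s); rewrite /= zs us ss zz sz.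
have [s [us ss sz]] := H 9 isT; exists s; split => // z.
apply/idP/idP => [|zz]; first exact/allP.
rewrite -[_ \in _]negbK; apply/negP => zs.
by have := @size_bzero (z :: s); rewrite /= zs us zz sz ss => /(_ isT isT).
Qed.
End NineZeros.

(** * The signature bound *)

Section Morphism.
Variables (F G : comPzRingType) (f : {rmorphism F -> G}).
Variables (t : F) (a b : nat -> F) (t' : G) (a' b' : nat -> G).
Hypotheses (ft : f t = t') (fa : forall k, f (a k) = a' k) (fb : forall k, f (b k) = b' k).

Lemma bcub1_morph x y : f (bcub1 t a x y) = bcub1 t' a' (f x) (f y).
Proof. by rewrite /bcub1 !(rmorphD, rmorphM, rmorphXn) ft !fa. Qed.

Lemma bcub2_morph x y : f (bcub2 t b x y) = bcub2 t' b' (f x) (f y).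
Proof. by rewrite /bcub2 !(rmorphD, rmorphN, rmorphM, rmorphXn) ft !fb. Qed.

Lemma bezoutian_morph x y u v :
  f (bezoutian t a b x y u v) = bezoutian t' a' b' (f x) (f y) (f u) (f v).
Proof.
rewrite /bezoutian /bez11 /bez12 /bez21 /bez22.
by rewrite !(rmorphD, rmorphN, rmorphM, rmorphXn) ft !fa !fb.
Qed.
End Morphism.

Local Open Scope complex_scope.

Section Signature.
Variable R : rcfType.
Variables (t : R) (a b : nat -> R).
Local Notation K := R[i].
Let tC : K := t%:C.
Let aC k : K := (a k)%:C.
Let bC k : K := (b k)%:C.
Local Notation zero := (bzero tC aC bC).
Local Notation bz := (bez tC aC bC).
Hypothesis simple : forall z, zero z -> bz z z != 0.

Lemma Re_sum (T : Type) (r : seq T) (P : pred T) (f : T -> K) :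
  complex.Re (\sum_(i <- r | P i) f i) = \sum_(i <- r | P i) complex.Re (f i).
Proof. by apply: (big_morph (@complex.Re R)) => // -[? ?] [? ?]. Qed.

Let ReM (x : R) (z : K) : complex.Re (x%:C * z) = x * complex.Re z.
Proof. by case: z => u v /=; rewrite mul0r subr0. Qed.

Let cj (z : K * K) : K * K := (z.1^*, z.2^*).
Let cjK : involutive cj.
Proof. by case=> x y; rewrite /cj /= !conjcK. Qed.

Let conj_t : conjc tC = tC. Proof. exact: conjc_real. Qed.
Let conj_a k : conjc (aC k) = aC k. Proof. exact: conjc_real. Qed.
Let conj_b k : conjc (bC k) = bC k. Proof. exact: conjc_real. Qed.

Let bez_cj z w : bz (cj z) (cj w) = (bz z w)^*.
Proof. by rewrite /bez (bezoutian_morph conj_t conj_a conj_b). Qed.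

Let zero_cj z : zero (cj z) = zero z.
Proof.
rewrite /bzero -(bcub1_morph conj_t conj_a) -(bcub2_morph conj_t conj_b).
by rewrite !conjc_eq0.
Qed.

(** Lexicographic positivity of the imaginary parts selects one point from each conjugate pair of
    non-real points. *)
Let upper (z : K * K) :=
  (0 < complex.Im z.1) || (complex.Im z.1 == 0) && (0 < complex.Im z.2).
Let lower z := upper (cj z).
Let isreal (z : K * K) := (complex.Im z.1 == 0) && (complex.Im z.2 == 0).

Let trichotomy z :
  [\/ [/\ isreal z, upper z = false & lower z = false],
       [/\ isreal z = false, upper z & lower z = false]
     | [/\ isreal z = false, upper z = false & lower z]].
Proof.
case: z => [[x x'] [y y']]; rewrite /isreal /lower /upper /= !oppr_gt0 !oppr_eq0.
case: (ltgtP x' 0) => _; case: (ltgtP y' 0) => _; rewrite ?(orbT, orbF) //=;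
  by [constructor 1|constructor 2|constructor 3].
Qed.

Let cj_real z : isreal z -> cj z = z.
Proof.
by case: z => [[x x'] [y y']] /andP[/= /eqP-> /eqP->]; rewrite /cj /= !oppr0.
Qed.

Lemma signature_bound : exists s : seq (R * R),
  [/\ uniq s,
      forall z, z \in s <-> bcub1 t a z.1 z.2 = 0 /\ bcub2 t b z.1 z.2 = 0 &
      exists2 k, (size s + k.*2 = 9)%N &
        (count (fun z => bezoutian t a b z.1 z.2 z.1 z.2 < 0)%R s + k <= 4)%N].
Proof.
have t_neq : 1 + tC ^+ 2 != 0.
  have -> : 1 + tC ^+ 2 = (1 + t ^+ 2)%:C by rewrite rmorphD rmorphXn rmorph1.
  by rewrite fmorph_eq0 gt_eqF // ltr_pwDl // sqr_ge0.
have [S [uS sS memS]] := nine_bzeros t_neq simple.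
pose re (z : K * K) := (complex.Re z.1, complex.Re z.2).
pose im (z : R * R) : K * K := (z.1%:C, z.2%:C).
have imK : cancel im re by case.
have reK z : isreal z -> im (re z) = z.
  by case: z => [[x x'] [y y']] /andP[/= /eqP-> /eqP->].
have imreal z : isreal (im z) by rewrite /isreal /= !eqxx.
have zero_im z : zero (im z) = (bcub1 t a z.1 z.2 == 0) && (bcub2 t b z.1 z.2 == 0).
  by rewrite /bzero /= -2!(fmorph_eq0 (real_complex R))
    (bcub1_morph (t' := tC) (a' := aC)) // (bcub2_morph (t' := tC) (b' := bC)).
have bez_im z : bz (im z) (im z) = (bezoutian t a b z.1 z.2 z.1 z.2)%:C.
  by rewrite /bez (bezoutian_morph (t' := tC) (a' := aC) (b' := bC)).
pose s := map re (filter isreal S).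
have us : uniq s.
  rewrite map_inj_in_uniq ?filter_uniq // => x y.
  by rewrite !mem_filter => /andP[xr _] /andP[yr _] e; rewrite -(reK x) // e reK.
have mems z : (z \in s) = (bcub1 t a z.1 z.2 == 0) && (bcub2 t b z.1 z.2 == 0).
  rewrite -zero_im -memS; apply/mapP/idP => [[w]|zS].
    by rewrite mem_filter => /andP[wr wS] ->; rewrite reK.
  by exists (im z); rewrite ?imK // mem_filter imreal.
pose k := count upper S.
have lowerE : count lower S = k.
  have -> : count lower S = count upper (map cj S) by rewrite count_map.
  apply/permP/uniq_perm => //; first by rewrite map_inj_uniq //; apply: (can_inj cjK).
  move=> z; apply/mapP/idP => [[w wS ->]|zS]; first by rewrite memS zero_cj -memS.
  by exists (cj z); rewrite ?cjK // memS zero_cj -memS.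
have sizes : (size s + k.*2 = 9)%N.
  rewrite -sS size_map size_filter -addnn -{2}lowerE /k -!sum1_count -sum1_size.
  rewrite !(big_mkcond _ (fun=> 1%N)) /= -!big_split; apply: eq_bigr => z _ /=.
  by have [] := trichotomy z => -[-> -> ->].
exists s; split => //; first by move=> z; rewrite mems; split=> [/andP[/eqP + /eqP]|[-> ->]]; rewrite ?eqxx.
exists k => //.
(* The weights are [xi = theta om], where [theta] is supported on [B] up to conjugation and [om] makes [om ^+ 2 * bz z z] equal to -1 off the real zeros. *)
pose neg z := isreal z && (complex.Re (bz z z) < 0).
pose B := filter (fun z => neg z || upper z) S.
have sB : (count (fun z => bezoutian t a b z.1 z.2 z.1 z.2 < 0)%R s + k)%N = size B.
  rewrite size_filter /s count_map count_filter /k -!sum1_count.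
  rewrite !(big_mkcond _ (fun=> 1%N)) /= -!big_split; apply: eq_bigr => z _ /=.
  rewrite /neg andbC; have [] := trichotomy z => -[zr -> _]; rewrite zr //=.
    by rewrite -(reK z zr) bez_im /= addn0 orbF.
rewrite sB leqNgt; apply/negP => ltB.
have uB : uniq B by rewrite filter_uniq.
pose rep z := if lower z then cj z else z.
pose om z : K := if upper z then 'i / sqrtc (bz z z)
  else if lower z then ('i / sqrtc (bz (cj z) (cj z)))^* else 1.
pose g (c : 'I_4) (z : K * K) : K := [:: 1; z.1; z.2; z.1 ^+ 2 - z.2 ^+ 2]`_c.
pose b_ (j : 'I_(size B)) := nth (0, 0) B j.
(* Real parts suffice: for conjugation invariant weights each [L (g c)] is real, so there are four
   real equations in [size B] > 4 real unknowns, one per element of [B]. *)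
have [th th0 thM] := left_kernel (\matrix_(j < size B, c < 4)
  \sum_(z <- S | b_ j == rep z) complex.Re (om z * g c z)) ltB.
pose theta z := \sum_(j < size B | b_ j == rep z) th 0 j.
pose xi z := (theta z)%:C * om z.
pose L (f : K * K -> K) := \sum_(z <- S) xi z * f z.
have ReL (c : 'I_4) : complex.Re (L (g c)) = 0.
  have := congr1 (fun M : 'rV_4 => M 0 c) thM; rewrite !mxE => E.
  rewrite -[RHS]E Re_sum.
  under eq_bigr => z _ do rewrite -mulrA ReM /theta mulr_suml.
  rewrite (exchange_big_dep xpredT) //=; apply: eq_bigr => j _.
  by rewrite mxE mulr_sumr.
have xi_cj z : z \in S -> xi (cj z) = (xi z)^*.
  move=> zS; have th_cj : theta (cj z) = theta z.
    rewrite /theta /rep {1}/lower cjK.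
    by have [] := trichotomy z => -[zr -> ->] //; rewrite cj_real.
  rewrite /xi th_cj rmorphM /= oppr0 complexr0 /om -/(lower z) /(lower (cj z)) cjK; congr (_ * _).
  by have [] := trichotomy z => -[zr -> ->]; rewrite ?conjc1 ?conjcK.
have L_cj f : (forall z, f (cj z) = (f z)^*) -> (L f)^* = L f.
  move=> fcj; rewrite /L rmorph_sum /=.
  have pS : perm_eq S (map cj S).
    apply: uniq_perm => //; first by rewrite map_inj_uniq //; apply: (can_inj cjK).
    move=> z; apply/idP/mapP => [zS|[w wS ->]]; last by rewrite memS zero_cj -memS.
    by exists (cj z); rewrite ?cjK // memS zero_cj -memS.
  rewrite [RHS](perm_big _ pS) big_map; apply: eq_big_seq => z zS.
  by rewrite rmorphM /= fcj xi_cj.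
have Lr f : (forall z, f (cj z) = (f z)^*) -> L f = (complex.Re (L f))%:C.
  by move=> /L_cj; case: (L f) => u v [/eqP]; rewrite eq_sym -addr_eq0 -mulr2n mulrn_eq0 /= => /eqP->.
have Lg (c : 'I_4) : L (g c) = 0.
  rewrite Lr ?ReL // => z; case: c => [[|[|[|[|n]]]] lc] //; rewrite /g /=.
  - by apply/eqP; rewrite eq_complex /= oppr0 !eqxx.
  - by rewrite rmorphB !rmorphXn.
have L1 : L (fun=> 1) = 0 := Lg 0.
have Lx : L (fun z => z.1) = 0 := Lg 1.
have Ly : L (fun z => z.2) = 0 := Lg 2%:R.
have Lxy : L (fun z => z.2 ^+ 2) = L (fun z => z.1 ^+ 2).
  apply/esym/eqP; rewrite -subr_eq0 -(Lg 3%:R) /L -sumrB.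
  by apply/eqP/eq_bigr => z _; rewrite /g /= mulrBr.
pose T z := complex.Re (xi z ^+ 2 * bz z z).
have QE : \sum_(z <- S) T z =
    complex.Re (L (fun z => z.1 ^+ 2)) ^+ 2 *+ 2
    + (1 + t ^+ 2) * complex.Re (L (fun z => z.1 * z.2)) ^+ 2.
  rewrite -Re_sum.
  (* The off-diagonal terms of the double sum vanish by [bez_neq]; the double sum can then be
     expanded in moments. *)
  have -> : \sum_(z <- S) xi z ^+ 2 * bz z z =
      \sum_(z <- S) xi z * \sum_(w <- S) xi w * bz z w.
    apply: eq_big_seq => z zS; rewrite (bigD1_seq z) //= big_seq_cond big1 ?addr0.
      by rewrite expr2 mulrA.
    by move=> w /andP[wS wz]; rewrite bez_neq ?mulr0 // -?memS // eq_sym.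
  have Lm n : \sum_(i <- S) xi i * monom9 i.1 i.2 n = L (fun z => monom9 z.1 z.2 n) by [].
  under eq_bigr => z _.
    rewrite (bez_sum tC aC bC S z xi id); under eq_bigr => j _ do rewrite Lm.
    over.
  have Lm0 : L (fun z => monom9 z.1 z.2 0) = 0.
    by rewrite -[RHS]L1; apply: eq_bigr => z _; rewrite /monom9 /=; congr (_ * _); ring.
  have Lm1 : L (fun z => monom9 z.1 z.2 1) = 0.
    by rewrite -[RHS]Lx; apply: eq_bigr => z _; rewrite /monom9 /=; congr (_ * _); ring.
  have Lm3 : L (fun z => monom9 z.1 z.2 3) = 0.
    by rewrite -[RHS]Ly; apply: eq_bigr => z _; rewrite /monom9 /=; congr (_ * _); ring.
  have Lm2 : L (fun z => monom9 z.1 z.2 2) = L (fun z => z.1 ^+ 2).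
    by apply: eq_bigr => z _; rewrite /monom9 /=; congr (_ * _); ring.
  have Lm4 : L (fun z => monom9 z.1 z.2 4) = L (fun z => z.1 * z.2).
    by apply: eq_bigr => z _; rewrite /monom9 /=; congr (_ * _); ring.
  have Lm6 : L (fun z => monom9 z.1 z.2 6) = L (fun z => z.1 ^+ 2).
    by rewrite -Lxy; apply: eq_bigr => z _; rewrite /monom9 /=; congr (_ * _); ring.
  pose l2 := L (fun z => z.1 ^+ 2); pose l4 := L (fun z => z.1 * z.2).
  pose l5 := L (fun z => monom9 z.1 z.2 5).
  pose l7 := L (fun z => monom9 z.1 z.2 7).
  pose l8 := L (fun z => monom9 z.1 z.2 8).
  (* The lower coefficients of the cubics and the moments of degree above 2 occur only in [c0],
     [c1], [c2], which multiply L(1), L(x), L(y) and so disappear. The values of [l5], [l7], [l8]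
     never matter. *)
  pose c0 := l2 * (bC 2 - aC 4 * bC 3)
    + l4 * (aC 3 * bC 5 - tC * bC 1 - aC 4 * bC 4 - aC 5 * bC 3 + tC * aC 2)
    + l5 * (bC 5 - tC * bC 3 + tC * aC 4) + l2 * (aC 1 - aC 5 * bC 4)
    + l7 * (aC 3 - tC * bC 4 + tC * aC 5) + l8 * (1 + tC ^+ 2).
  pose c1 := l2 * bC 4 + l4 * (bC 5 - tC * bC 3 + tC * aC 4)
    + l2 * (aC 3 + tC * aC 5) + l7 * (1 + tC ^+ 2).
  pose c2 := l2 * (bC 5 - tC * bC 3) + l4 * (aC 3 - tC * bC 4 + tC * aC 5)
    + l5 * (1 + tC ^+ 2) + l2 * aC 4.
  have -> : \sum_(z <- S) xi z * (\sum_(j < 9)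
      (bez_coef tC aC bC z.1 z.2)`_j * L (fun z => monom9 z.1 z.2 j)) =
    \sum_(z <- S) (c0 * (xi z * 1) + c1 * (xi z * z.1) + c2 * (xi z * z.2)
      + l2 * (1 - tC) * (xi z * z.1 ^+ 2) + l2 * (1 + tC) * (xi z * z.2 ^+ 2)
      + l4 * (1 + tC ^+ 2) * (xi z * (z.1 * z.2))).
    apply: eq_bigr => z _; rewrite !big_ord_recl big_ord0 /= /bump /=.
    rewrite !addn0 !add1n Lm0 Lm1 Lm2 Lm3 Lm4 Lm6 -/l2 -/l4 -/l5 -/l7 -/l8 /c0 /c1 /c2; ring.
  rewrite !big_split /= -!mulr_sumr.
  rewrite -[\sum_(z <- S) xi z * 1]/(L (fun=> 1)) -[\sum_(z <- S) xi z * z.1]/(L (fun z => z.1)).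
  rewrite -[\sum_(z <- S) xi z * z.2]/(L (fun z => z.2)).
  rewrite -[\sum_(z <- S) xi z * z.1 ^+ 2]/l2.
  rewrite -[\sum_(z <- S) xi z * z.2 ^+ 2]/(L (fun z => z.2 ^+ 2)).
  rewrite -[\sum_(z <- S) xi z * (z.1 * z.2)]/l4 L1 Lx Ly Lxy -/l2.
  have l2r : l2 = (complex.Re l2)%:C by apply: Lr => z; rewrite rmorphXn.
  have l4r : l4 = (complex.Re l4)%:C by apply: Lr => z; rewrite rmorphM.
  transitivity (complex.Re (complex.Re l2 ^+ 2 *+ 2 + (1 + t ^+ 2) * complex.Re l4 ^+ 2)%:C) => //.
  congr complex.Re; rewrite {1 2 3 4 5}l2r {1 2}l4r /tC.
  rewrite !(rmorphD, rmorphM, rmorphXn, rmorphMn) rmorph1; ring.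
have B_notin z : z \notin B -> \sum_(j < size B | b_ j == z) th 0 j = 0.
  by move=> zB; rewrite big1 // => j /eqP jz; case/negP: zB; rewrite -jz mem_nth.
have Tle z : z \in S -> T z <= 0 /\ (T z = 0 -> z \in B -> theta z = 0).
  move=> zS; rewrite /T /xi exprMn -rmorphXn -mulrA ReM /om.
  have bz0 w : w \in S -> bz w w != 0 by rewrite memS => /simple.
  have sq w : w \in S -> ('i / sqrtc (bz w w)) ^+ 2 * bz w w = -1.
    by move=> wS; rewrite exprMn exprVn sqr_sqrtc sqr_i -mulrA mulVf ?mulr1 // bz0.
  have [] := trichotomy z => -[zr u l]; rewrite u ?l.
  - rewrite expr1n mul1r.
    have repz : rep z = z by rewrite /rep l.
    have [lt0|ge0] := ltP (complex.Re (bz z z)) 0.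
      split; first by rewrite nmulr_lle0 // sqr_ge0.
      by move=> /eqP; rewrite mulf_eq0 (lt_eqF lt0) orbF sqrf_eq0 => /eqP.
    (* A real zero with a nonnegative Bezoutian is not in [B], so it received no weight. *)
    have th_z : theta z = 0.
      by rewrite /theta repz B_notin // mem_filter /neg u orbF zr /= ltNge ge0.
    by rewrite th_z expr0n mul0r.
  - rewrite sq //= mulrN1 oppr_le0 sqr_ge0; split=> // /eqP.
    by rewrite oppr_eq0 sqrf_eq0 => /eqP.
  - have -> : bz z z = (bz (cj z) (cj z))^* by rewrite bez_cj conjcK.
    rewrite -rmorphXn -rmorphM sq ?memS ?zero_cj -?memS //= mulrN1 oppr_le0 sqr_ge0.
    by split=> // /eqP; rewrite oppr_eq0 sqrf_eq0 => /eqP.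
(* The sum of the [T z] is nonnegative by [QE] and termwise nonpositive by [Tle]. Hence every term
   is zero and [theta] vanishes on [B], against [th0]. *)
have T0 : \sum_(z <- S) - T z = 0.
  apply/eqP; rewrite eq_le; apply/andP; split.
    rewrite sumrN oppr_le0 QE addr_ge0 ?mulrn_wge0 ?sqr_ge0 //.
    by rewrite mulr_ge0 ?sqr_ge0 // addr_ge0 ?sqr_ge0.
  rewrite big_seq_cond; apply: sumr_ge0 => z /andP[zS _].
  by rewrite oppr_ge0; case: (Tle z zS).
case/eqP: th0; apply/rowP => j; rewrite mxE.
have jB : b_ j \in B by apply: mem_nth.
have jS : b_ j \in S by move: jB; rewrite mem_filter => /andP[].
have -> : th 0 j = theta (b_ j).
  have repj : rep (b_ j) = b_ j.
    move: jB; rewrite mem_filter /rep /neg => /andP[+ _].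
    by have [] := trichotomy (b_ j) => -[-> -> ->].
  rewrite /theta repj (bigD1 j) //= big1 ?addr0 // => i /andP[].
  by rewrite /b_ nth_uniq // => /eqP/val_inj->; rewrite eqxx.
have [_] := Tle _ jS; apply => //; apply/eqP; rewrite -oppr_eq0.
move/eqP: T0; rewrite big_seq_cond psumr_eq0 => [/allP/(_ _ jS)|z /andP[zS _]].
  by rewrite jS /=.
by rewrite oppr_ge0; case: (Tle z zS).
Qed.
End Signature.

(** * Reduction to normal form *)

Section Expansion.
Variable F : comPzRingType.

Definition co (c : coefs4 F) (i j : nat) : F := c (inord i) (inord j).

Lemma sum_ord5 (P : nat -> nat -> bool) (f : 'I_5 -> 'I_5 -> F) :
  \sum_(i < 5) \sum_(j < 5 | P i j) f i j =
  foldr +%R 0 [seq f (inord ij.1) (inord ij.2) |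
               ij <- [seq (i, j) | i <- iota 0 5, j <- iota 0 5] & P ij.1 ij.2].
Proof.
transitivity (\sum_(ij <- [seq (i, j) | i <- iota 0 5, j <- iota 0 5] | P ij.1 ij.2)
    f (inord ij.1) (inord ij.2)); last by rewrite -big_filter foldrE big_map.
rewrite [RHS]big_mkcond big_allpairs_dep -[iota 0 5]/(index_iota 0 5).
rewrite big_mkord; apply: eq_bigr => i _; rewrite [RHS]big_mkord [LHS]big_mkcond.
by apply: eq_bigr => j _ /=; rewrite !inord_val.
Qed.

Ltac expand P := rewrite (sum_ord5 P) /= !inordK // /co /=; ring.

Lemma pevalE (c : coefs4 F) x y : peval c x y =
  co c 0 0 + co c 1 0 * x + co c 0 1 * y
  + co c 2 0 * x ^+ 2 + co c 1 1 * x * y + co c 0 2 * y ^+ 2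
  + co c 3 0 * x ^+ 3 + co c 2 1 * x ^+ 2 * y + co c 1 2 * x * y ^+ 2 + co c 0 3 * y ^+ 3
  + co c 4 0 * x ^+ 4 + co c 3 1 * x ^+ 3 * y + co c 2 2 * x ^+ 2 * y ^+ 2
  + co c 1 3 * x * y ^+ 3 + co c 0 4 * y ^+ 4.
Proof. rewrite /peval; expand (fun i j => i + j <= 4)%N. Qed.

Lemma ptopE (c : coefs4 F) x y : ptop c x y =
  co c 4 0 * x ^+ 4 + co c 3 1 * x ^+ 3 * y + co c 2 2 * x ^+ 2 * y ^+ 2
  + co c 1 3 * x * y ^+ 3 + co c 0 4 * y ^+ 4.
Proof. rewrite /ptop; expand (fun i j => i + j == 4)%N. Qed.

Lemma pdxE (c : coefs4 F) x y : pdx c x y =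
  co c 1 0 + 2%:R * co c 2 0 * x + co c 1 1 * y
  + 3%:R * co c 3 0 * x ^+ 2 + 2%:R * co c 2 1 * x * y + co c 1 2 * y ^+ 2
  + 4%:R * co c 4 0 * x ^+ 3 + 3%:R * co c 3 1 * x ^+ 2 * y
  + 2%:R * co c 2 2 * x * y ^+ 2 + co c 1 3 * y ^+ 3.
Proof. rewrite /pdx; expand (fun i j => i + j <= 4)%N. Qed.

Lemma pdyE (c : coefs4 F) x y : pdy c x y =
  co c 0 1 + co c 1 1 * x + 2%:R * co c 0 2 * y
  + co c 2 1 * x ^+ 2 + 2%:R * co c 1 2 * x * y + 3%:R * co c 0 3 * y ^+ 2
  + co c 3 1 * x ^+ 3 + 2%:R * co c 2 2 * x ^+ 2 * y
  + 3%:R * co c 1 3 * x * y ^+ 2 + 4%:R * co c 0 4 * y ^+ 3.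
Proof. rewrite /pdy; expand (fun i j => i + j <= 4)%N. Qed.

Lemma pdxxE (c : coefs4 F) x y : pdxx c x y =
  2%:R * co c 2 0 + 6%:R * co c 3 0 * x + 2%:R * co c 2 1 * y
  + 12%:R * co c 4 0 * x ^+ 2 + 6%:R * co c 3 1 * x * y + 2%:R * co c 2 2 * y ^+ 2.
Proof. rewrite /pdxx; expand (fun i j => i + j <= 4)%N. Qed.

Lemma pdyyE (c : coefs4 F) x y : pdyy c x y =
  2%:R * co c 0 2 + 2%:R * co c 1 2 * x + 6%:R * co c 0 3 * y
  + 2%:R * co c 2 2 * x ^+ 2 + 6%:R * co c 1 3 * x * y + 12%:R * co c 0 4 * y ^+ 2.
Proof. rewrite /pdyy; expand (fun i j => i + j <= 4)%N. Qed.

Lemma pdxyE (c : coefs4 F) x y : pdxy c x y =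
  co c 1 1 + 2%:R * co c 2 1 * x + 2%:R * co c 1 2 * y
  + 3%:R * co c 3 1 * x ^+ 2 + 4%:R * co c 2 2 * x * y + 3%:R * co c 1 3 * y ^+ 2.
Proof. rewrite /pdxy; expand (fun i j => i + j <= 4)%N. Qed.

Definition quartic (l : seq (seq F)) : coefs4 F := fun i j => (nth [::] l i)`_j.

Lemma co_quartic l i j : (i < 5)%N -> (j < 5)%N -> co (quartic l) i j = (nth [::] l i)`_j.
Proof. by move=> li lj; rewrite /co /quartic !inordK. Qed.

(* The coefficients of c(p x + q y, r x + s y). *)
Definition comp_lin (c : coefs4 F) (p q r s : F) : coefs4 F := quartic
  [:: [:: co c 0 0; co c 1 0 * q + co c 0 1 * s;
          co c 2 0 * q ^+ 2 + co c 1 1 * q * s + co c 0 2 * s ^+ 2;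
          co c 3 0 * q ^+ 3 + co c 2 1 * q ^+ 2 * s + co c 1 2 * q * s ^+ 2 + co c 0 3 * s ^+ 3;
          co c 4 0 * q ^+ 4 + co c 3 1 * q ^+ 3 * s + co c 2 2 * q ^+ 2 * s ^+ 2
          + co c 1 3 * q * s ^+ 3 + co c 0 4 * s ^+ 4];
      [:: co c 1 0 * p + co c 0 1 * r;
          co c 2 0 * 2%:R * p * q + co c 1 1 * (p * s + q * r) + co c 0 2 * 2%:R * r * s;
          co c 3 0 * 3%:R * p * q ^+ 2 + co c 2 1 * (2%:R * p * q * s + q ^+ 2 * r)
          + co c 1 2 * (p * s ^+ 2 + 2%:R * q * r * s) + co c 0 3 * 3%:R * r * s ^+ 2;
          co c 4 0 * 4%:R * p * q ^+ 3 + co c 3 1 * (3%:R * p * q ^+ 2 * s + q ^+ 3 * r)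
          + co c 2 2 * (2%:R * p * q * s ^+ 2 + 2%:R * q ^+ 2 * r * s)
          + co c 1 3 * (p * s ^+ 3 + 3%:R * q * r * s ^+ 2) + co c 0 4 * 4%:R * r * s ^+ 3];
      [:: co c 2 0 * p ^+ 2 + co c 1 1 * p * r + co c 0 2 * r ^+ 2;
          co c 3 0 * 3%:R * p ^+ 2 * q + co c 2 1 * (p ^+ 2 * s + 2%:R * p * q * r)
          + co c 1 2 * (2%:R * p * r * s + q * r ^+ 2) + co c 0 3 * 3%:R * r ^+ 2 * s;
          co c 4 0 * 6%:R * p ^+ 2 * q ^+ 2
          + co c 3 1 * (3%:R * p ^+ 2 * q * s + 3%:R * p * q ^+ 2 * r)
          + co c 2 2 * (p ^+ 2 * s ^+ 2 + 4%:R * p * q * r * s + q ^+ 2 * r ^+ 2)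
          + co c 1 3 * (3%:R * p * r * s ^+ 2 + 3%:R * q * r ^+ 2 * s)
          + co c 0 4 * 6%:R * r ^+ 2 * s ^+ 2];
      [:: co c 3 0 * p ^+ 3 + co c 2 1 * p ^+ 2 * r + co c 1 2 * p * r ^+ 2 + co c 0 3 * r ^+ 3;
          co c 4 0 * 4%:R * p ^+ 3 * q + co c 3 1 * (p ^+ 3 * s + 3%:R * p ^+ 2 * q * r)
          + co c 2 2 * (2%:R * p ^+ 2 * r * s + 2%:R * p * q * r ^+ 2)
          + co c 1 3 * (3%:R * p * r ^+ 2 * s + q * r ^+ 3) + co c 0 4 * 4%:R * r ^+ 3 * s];
      [:: co c 4 0 * p ^+ 4 + co c 3 1 * p ^+ 3 * r + co c 2 2 * p ^+ 2 * r ^+ 2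
          + co c 1 3 * p * r ^+ 3 + co c 0 4 * r ^+ 4]].

Section CompLin.
Variables (c : coefs4 F) (p q r s : F).
Local Notation c' := (comp_lin c p q r s).

Lemma ptop_comp_lin x y : ptop c' x y = ptop c (p * x + q * y) (r * x + s * y).
Proof. rewrite !ptopE !co_quartic //=; ring. Qed.

Lemma pdx_comp_lin x y : pdx c' x y =
  p * pdx c (p * x + q * y) (r * x + s * y) + r * pdy c (p * x + q * y) (r * x + s * y).
Proof. rewrite !(pdxE, pdyE) !co_quartic //=; ring. Qed.

Lemma pdy_comp_lin x y : pdy c' x y =
  q * pdx c (p * x + q * y) (r * x + s * y) + s * pdy c (p * x + q * y) (r * x + s * y).
Proof. rewrite !(pdxE, pdyE) !co_quartic //=; ring. Qed.

Lemma hess_comp_lin x y : hess_det c' x y =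
  (p * s - q * r) ^+ 2 * hess_det c (p * x + q * y) (r * x + s * y).
Proof.
(* The factors are the entries of the Hessian matrix after the congruence by the linear change; what
   remains is multiplicativity of the determinant. *)
have -> : hess_det c' x y =
    (p ^+ 2 * pdxx c (p * x + q * y) (r * x + s * y)
     + 2%:R * p * r * pdxy c (p * x + q * y) (r * x + s * y)
     + r ^+ 2 * pdyy c (p * x + q * y) (r * x + s * y))
  * (q ^+ 2 * pdxx c (p * x + q * y) (r * x + s * y)
     + 2%:R * q * s * pdxy c (p * x + q * y) (r * x + s * y)
     + s ^+ 2 * pdyy c (p * x + q * y) (r * x + s * y))
  - (p * q * pdxx c (p * x + q * y) (r * x + s * y)
     + (p * s + q * r) * pdxy c (p * x + q * y) (r * x + s * y)
     + r * s * pdyy c (p * x + q * y) (r * x + s * y)) ^+ 2.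
  rewrite /hess_det; congr (_ * _ - _ ^+ 2);
    rewrite !(pdxxE, pdyyE, pdxyE) !co_quartic //=; ring.
rewrite /hess_det; ring.
Qed.
End CompLin.
End Expansion.

Section Normalisation.
Variable F : fieldType.
Variable c : coefs4 F.
Let A := co c 4 0.

(* The lower order coefficients of pdx c / (4 A) and of - pdy c / (4 A). *)
Definition ncoef1 (k : nat) : F :=
  [:: co c 1 0; 2%:R * co c 2 0; co c 1 1; 3%:R * co c 3 0; 2%:R * co c 2 1; co c 1 2]`_k
  / (4%:R * A).
Definition ncoef2 (k : nat) : F :=
  [:: co c 0 1; co c 1 1; 2%:R * co c 0 2; co c 2 1; 2%:R * co c 1 2; 3%:R * co c 0 3]`_k
  / - (4%:R * A).
Definition ntau : F := 2%:R * co c 2 2 / (4%:R * A).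

Hypotheses (two0 : 2%:R != 0 :> F) (A0 : A != 0).
Hypotheses (c31 : co c 3 1 = 0) (c13 : co c 1 3 = 0) (c04 : co c 0 4 = - A).

Let four0 : 4%:R != 0 :> F.
Proof. by rewrite (natrM _ 2 2) mulf_neq0. Qed.

Lemma bcub1_pdx x y : bcub1 ntau ncoef1 x y = pdx c x y / (4%:R * A).
Proof.
rewrite /bcub1 /ncoef1 /ntau /= pdxE c31 c13 -/A; field; by rewrite A0 four0.
Qed.

Lemma bcub2_pdy x y : bcub2 ntau ncoef2 x y = pdy c x y / - (4%:R * A).
Proof.
rewrite /bcub2 /ncoef2 /ntau /= pdyE c31 c13 c04 -/A; field; by rewrite oppr_eq0 mulf_eq0 negb_or A0 four0.
Qed.

(** The minus sign comes from dividing the second derivative by - 4 A. Critical points with a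
    positive Hessian determinant are thus the ones counted in [signature_bound]. *)
Lemma bezoutian_hess x y :
  bezoutian ntau ncoef1 ncoef2 x y x y = - (hess_det c x y / (4%:R * A) ^+ 2).
Proof.
rewrite /bezoutian /bez11 /bez12 /bez21 /bez22 /ncoef1 /ncoef2 /ntau /=.
rewrite /hess_det pdxxE pdyyE pdxyE c31 c13 c04 -/A; field; by rewrite A0 four0 oppr_eq0 mulf_neq0.
Qed.
End Normalisation.

Section EqCoefs.
Variables (F : comPzRingType) (c c' : coefs4 F).
Hypothesis e : c =2 c'.

Lemma eq_ptop x y : ptop c x y = ptop c' x y.
Proof. by rewrite !ptopE /co !e. Qed.
Lemma eq_crit x y : is_crit c x y <-> is_crit c' x y.
Proof. by rewrite /is_crit !pdxE !pdyE /co !e. Qed.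
Lemma eq_hess x y : hess_det c x y = hess_det c' x y.
Proof. by rewrite /hess_det !pdxxE !pdyyE !pdxyE /co !e. Qed.
End EqCoefs.

Section NormalForm.
Variable R : realType.
Implicit Types c : coefs4 R.

Lemma co_cplx c i j : co (cplx c) i j = (co c i j)%:C.
Proof. by []. Qed.

Lemma cplx_comp_lin c p q r s :
  cplx (comp_lin c p q r s) =2 comp_lin (cplx c) p%:C q%:C r%:C s%:C.
Proof.
move=> i j; have [li lj] := (ltn_ord i, ltn_ord j).
rewrite /cplx /comp_lin /quartic /co /=.
case: i j li lj => [i _] [j _] /= li lj.
do 5 (case: i li => [_|i li]; [
do 5 (case: j lj => [_|j lj]; [rewrite /= ?nth_nil;
  by rewrite ?(rmorphD, rmorphM, rmorphXn, rmorph_nat, rmorph0)|]); by []|]); by [].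
Qed.

(* The coefficient is the derivative of the top form at its zero (p, r) in the direction (q, s). *)
Lemma top_simple_root c p q r s : nondegenerate_top c -> p * s - q * r != 0 ->
  ptop c p r = 0 -> co (comp_lin c p q r s) 3 1 != 0.
Proof.
move=> [a [b [ab prodE]]] D0 root; apply/eqP => c31.
pose A k := a k * p%:C + b k * r%:C; pose B k := a k * q%:C + b k * s%:C.
have AB k l : k != l -> A k * B l - A l * B k != 0.
  move=> kl; have -> : A k * B l - A l * B k =
    (a k * b l - a l * b k) * (p * s - q * r)%:C.
    by rewrite rmorphB !rmorphM /A /B; ring.
  by rewrite mulf_neq0 ?ab // fmorph_eq0.
have E z : \prod_(k < 4) (A k + B k * z) = (co (comp_lin c p q r s) 2 2)%:C * z ^+ 2
    + (co (comp_lin c p q r s) 1 3)%:C * z ^+ 3 + (co (comp_lin c p q r s) 0 4)%:C * z ^+ 4.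
  transitivity (ptop (cplx (comp_lin c p q r s)) 1 z).
    rewrite (eq_ptop (cplx_comp_lin _ _ _ _ _)) ptop_comp_lin prodE.
    by apply: eq_bigr => k _; rewrite /A /B; ring.
  rewrite ptopE !co_cplx c31.
  have -> : co (comp_lin c p q r s) 4 0 = 0 by rewrite -root co_quartic // ptopE.
  by rewrite rmorph0; ring.
have E' z : \prod_(k < 4) (A k + B k * z) =
    let A_ n := A (inord n) in let B_ n := B (inord n) in
    (A_ 0 + B_ 0 * z) * (A_ 1 + B_ 1 * z) * (A_ 2 + B_ 2 * z) * (A_ 3 + B_ 3 * z).
  rewrite !big_ord_recl big_ord0 mulr1 !mulrA /=.
  by do !congr (_ * _); congr (A _ + B _ * _); apply: val_inj; rewrite /= inordK.
have AB' k l : (k < 4)%N -> (l < 4)%N -> k != l ->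
    A (inord k) * B (inord l) - A (inord l) * B (inord k) != 0.
  by move=> lk ll kl; apply: AB; rewrite -val_eqE /= !inordK.
(* Five values determine the quartic f in z: f(0) is the constant term, and 8 (f(1) - f(-1)) - (f(2)
   - f(-2)) is 12 times the linear coefficient. Both coefficients are zero on the right-hand
   side. *)
move: (E 0) (E 1) (E (-1)) (E 2%:R) (E (- 2%:R)); rewrite !E' /=.
move: (AB' 0 1) (AB' 0 2) (AB' 0 3) (AB' 1 2) (AB' 1 3) (AB' 2 3).
move: (A (inord 0)) (A (inord 1)) (A (inord 2)) (A (inord 3))
  (B (inord 0)) (B (inord 1)) (B (inord 2)) (B (inord 3)) => A0 A1 A2 A3 B0 B1 B2 B3.
move=> /(_ isT isT isT) n01 /(_ isT isT isT) n02 /(_ isT isT isT) n03.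
move=> /(_ isT isT isT) n12 /(_ isT isT isT) n13 /(_ isT isT isT) n23 e0 e1 e2 e3 e4.
have e : B0 * (A1 * A2 * A3) + B1 * (A0 * A2 * A3) + B2 * (A0 * A1 * A3) + B3 * (A0 * A1 * A2) = 0.
  have /mulfI : 12%:R != 0 :> R[i] by rewrite pnatr_eq0.
  apply; rewrite mulr0.
  transitivity (8%:R * ((A0 + B0 * 1) * (A1 + B1 * 1) * (A2 + B2 * 1) * (A3 + B3 * 1) - (A0 + B0 * (-1)) * (A1 + B1 * (-1)) * (A2 + B2 * (-1)) * (A3 + B3 * (-1)))
    - ((A0 + B0 * 2%:R) * (A1 + B1 * 2%:R) * (A2 + B2 * 2%:R) * (A3 + B3 * 2%:R) - (A0 + B0 * (- 2%:R)) * (A1 + B1 * (- 2%:R)) * (A2 + B2 * (- 2%:R)) * (A3 + B3 * (- 2%:R)))); first by ring.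
  by rewrite e1 e2 e3 e4; ring.
have {}e0 : A0 * A1 * A2 * A3 = 0 by move: e0; rewrite !mulr0 !addr0 !expr0n /= !mulr0 !addr0.
have Zl (Ak Al Bk Bl : R[i]) : Ak * Bl - Al * Bk != 0 -> Ak = 0 -> (Al != 0) /\ (Bk != 0).
  by move=> h z; move: h; rewrite z mul0r sub0r oppr_eq0 mulf_eq0 negb_or => /andP.
have Zr (Ak Al Bk Bl : R[i]) : Ak * Bl - Al * Bk != 0 -> Al = 0 -> (Ak != 0) /\ (Bl != 0).
  by move=> h z; move: h; rewrite z mul0r subr0 mulf_eq0 negb_or => /andP.
(* If one A vanishes, the linear coefficient reduces to the corresponding B times the other three
   A's, all nonzero by non-proportionality. *)
move/eqP: e; move/eqP: e0; rewrite !mulf_eq0 -!orbA => /or4P[] /eqP z.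
- have [[a1 b0] [a2 _] [a3 _]] := And3 (Zl _ _ _ _ n01 z) (Zl _ _ _ _ n02 z) (Zl _ _ _ _ n03 z).
  by rewrite z !(mul0r, mulr0, addr0, add0r) !mulf_eq0 (negPf b0) (negPf a1) (negPf a2) (negPf a3).
- have [[a0 b1] [a2 _] [a3 _]] := And3 (Zr _ _ _ _ n01 z) (Zl _ _ _ _ n12 z) (Zl _ _ _ _ n13 z).
  by rewrite z !(mul0r, mulr0, addr0, add0r) !mulf_eq0 (negPf b1) (negPf a0) (negPf a2) (negPf a3).
- have [[a0 b2] [a1 _] [a3 _]] := And3 (Zr _ _ _ _ n02 z) (Zr _ _ _ _ n12 z) (Zl _ _ _ _ n23 z).
  by rewrite z !(mul0r, mulr0, addr0, add0r) !mulf_eq0 (negPf b2) (negPf a0) (negPf a1) (negPf a3).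
- have [[a0 b3] [a1 _] [a2 _]] := And3 (Zr _ _ _ _ n03 z) (Zr _ _ _ _ n13 z) (Zr _ _ _ _ n23 z).
  by rewrite z !(mul0r, mulr0, addr0, add0r) !mulf_eq0 (negPf b3) (negPf a0) (negPf a1) (negPf a2).
Qed.

Lemma same_sign (x y : R) : 0 < x * y -> x * `|y| = y * `|x|.
Proof.
have [x0|x0|->] := ltrgtP x 0; last by rewrite mul0r ltxx.
- by rewrite nmulr_rgt0 // => y0; rewrite !ltr0_norm //; ring.
- by rewrite pmulr_rgt0 // => y0; rewrite !gtr0_norm //; ring.
Qed.

(* The two real lines become the axes; then the positive definite factor is diagonalised together with x y. *)
Lemma normal_form c : nondegenerate_top c -> top_two_real_lines c ->
  exists p q r s, let c' := comp_lin c p q r s in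
  [/\ p * s - q * r != 0, co c' 4 0 != 0, co c' 3 1 = 0, co c' 1 3 = 0 &
      co c' 0 4 = - co c' 4 0].
Proof.
move=> ndg [[u1 u2] [[v1 v2] /= [D0 lines]]].
have Du : u1 * v2 - v1 * u2 != 0 by rewrite [v1 * _]mulrC.
have topu : ptop c u1 u2 = 0 by apply/lines; left; ring.
have topv : ptop c v1 v2 = 0 by apply/lines; right; ring.
pose d := comp_lin c u1 v1 u2 v2.
have d40 : co d 4 0 = 0 by rewrite -topu co_quartic // ptopE.
have d04 : co d 0 4 = 0 by rewrite -topv co_quartic // ptopE.
have d31 : co d 3 1 != 0 by apply: top_simple_root.
have d13 : co d 1 3 != 0.
  have -> : co d 1 3 = co (comp_lin c v1 u1 v2 u2) 3 1 by rewrite !co_quartic //=; ring.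
  by apply: top_simple_root => //; rewrite -oppr_eq0 opprB.
have axes x y : x * y * (co d 3 1 * x ^+ 2 + co d 2 2 * x * y + co d 1 3 * y ^+ 2) = 0 ->
    x = 0 \/ y = 0.
  move=> e; have : ptop c (u1 * x + v1 * y) (u2 * x + v2 * y) = 0.
    by rewrite -ptop_comp_lin -/d ptopE d40 d04 -[RHS]e; ring.
  case/lines => h; [right|left]; apply: (mulfI Du); rewrite mulr0; apply/eqP;
    [rewrite -oppr_eq0|]; rewrite -[X in _ == X]h; apply/eqP; ring.
have disc : co d 2 2 ^+ 2 < 4%:R * co d 3 1 * co d 1 3.
  rewrite ltNge; apply/negP => le0.
  pose w := Num.sqrt (co d 2 2 ^+ 2 - 4%:R * co d 3 1 * co d 1 3).
  have w2 : w ^+ 2 = co d 2 2 ^+ 2 - 4%:R * co d 3 1 * co d 1 3 by rewrite sqr_sqrtr ?subr_ge0.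
  (* With a nonnegative discriminant the quadratic factor vanishes at both points (- be ± w, 2 al).
     Their second coordinate is nonzero, so both first coordinates must be zero, and their product 4
     al ga would vanish. *)
  have [|e1|/eqP] := axes (- co d 2 2 + w) (2%:R * co d 3 1).
  - by transitivity ((- co d 2 2 + w) * (2%:R * co d 3 1) * co d 3 1 *
      (w ^+ 2 - (co d 2 2 ^+ 2 - 4%:R * co d 3 1 * co d 1 3))); [ring|rewrite w2 subrr mulr0].
  - have [|e2|/eqP] := axes (- co d 2 2 - w) (2%:R * co d 3 1).
    + by transitivity ((- co d 2 2 - w) * (2%:R * co d 3 1) * co d 3 1 *
      (w ^+ 2 - (co d 2 2 ^+ 2 - 4%:R * co d 3 1 * co d 1 3))); [ring|rewrite w2 subrr mulr0].
    + have e3 : 4%:R * co d 3 1 * co d 1 3 = 0.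
        transitivity ((co d 2 2 ^+ 2 - w ^+ 2)); first by rewrite w2; ring.
        transitivity ((- co d 2 2 + w) * (- co d 2 2 - w)); first ring.
        by rewrite e1 mul0r.
      by move/eqP: e3; rewrite !mulf_eq0 (negPf d31) (negPf d13) pnatr_eq0.
    + by rewrite mulf_eq0 (negPf d31) pnatr_eq0.
  - by rewrite mulf_eq0 (negPf d31) pnatr_eq0.
pose al := co d 3 1; pose be := co d 2 2; pose ga := co d 1 3.
rewrite -/al -/be -/ga in d31 d13 disc.
have ag : 0 < al * ga by have := sqr_ge0 be; lra.
(* Substituting X = si (mu x + nu y), Y = ta (mu x - nu y) in X Y (al X^2 + be X Y + ga Y^2): since
   al si^2 = ga ta^2, the result is si ta (mu^2 x^2 - nu^2 y^2) (A mu^2 x^2 + B nu^2 y^2), without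
   odd powers. *)
pose si := Num.sqrt `|ga|; pose ta := Num.sqrt `|al|.
have si2 : si ^+ 2 = `|ga| by rewrite sqr_sqrtr.
have ta2 : ta ^+ 2 = `|al| by rewrite sqr_sqrtr.
have si0 : si != 0 by rewrite sqrtr_eq0 -ltNge normr_gt0.
have ta0 : ta != 0 by rewrite sqrtr_eq0 -ltNge normr_gt0.
have e1 : al * si ^+ 2 = ga * ta ^+ 2 by rewrite si2 ta2 same_sign.
pose A := 2%:R * al * si ^+ 2 + be * si * ta.
pose B := 2%:R * al * si ^+ 2 - be * si * ta.
have AB : 0 < A * B.
  have -> : A * B = (si * ta) ^+ 2 * (4%:R * al * ga - be ^+ 2).
    transitivity (4%:R * (al * si ^+ 2) * (al * si ^+ 2) - (be * si * ta) ^+ 2).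
      by rewrite /A /B; ring.
    by rewrite {2}e1; ring.
  by rewrite pmulr_rgt0 ?subr_gt0 // exprn_even_gt0 //= mulf_neq0.
have [A0 B0] : A != 0 /\ B != 0.
  by move: AB; split; apply: contraTneq AB => ->; rewrite ?mul0r ?mulr0 ltxx.
(* The scaling makes A mu^4 = B nu^4, because A and B have the same sign; the coefficients of x^4
   and y^4 become opposite. *)
pose mu := Num.sqrt (Num.sqrt `|B|); pose nu := Num.sqrt (Num.sqrt `|A|).
have mu4 : mu ^+ 4 = `|B| by rewrite (exprM _ 2 2) !sqr_sqrtr // sqrtr_ge0.
have nu4 : nu ^+ 4 = `|A| by rewrite (exprM _ 2 2) !sqr_sqrtr // sqrtr_ge0.
have mu0 : mu != 0 by rewrite sqrtr_eq0 -ltNge sqrtr_gt0 normr_gt0.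
have nu0 : nu != 0 by rewrite sqrtr_eq0 -ltNge sqrtr_gt0 normr_gt0.
exists (u1 * (si * mu) + v1 * (ta * mu)), (u1 * (si * nu) + v1 * (- ta * nu)),
  (u2 * (si * mu) + v2 * (ta * mu)), (u2 * (si * nu) + v2 * (- ta * nu)); set c' := comp_lin _ _ _ _ _.
have c40 : co c' 4 0 = mu ^+ 4 * si * ta * A.
  transitivity (co d 4 0 * (si * mu) ^+ 4 + mu ^+ 4 * si * ta *
    (al * si ^+ 2 + be * si * ta + ga * ta ^+ 2) + co d 0 4 * (ta * mu) ^+ 4).
    by rewrite /al /be /ga /d !co_quartic //=; ring.
  by rewrite d40 d04 -e1 /A; ring.
have c04 : co c' 0 4 = - (nu ^+ 4 * si * ta * B).
  transitivity (co d 4 0 * (si * nu) ^+ 4 - nu ^+ 4 * si * ta *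
    (al * si ^+ 2 - be * si * ta + ga * ta ^+ 2) + co d 0 4 * (ta * nu) ^+ 4).
    by rewrite /al /be /ga /d !co_quartic //=; ring.
  by rewrite d40 d04 -e1 /B; ring.
split.
- have -> : (u1 * (si * mu) + v1 * (ta * mu)) * (u2 * (si * nu) + v2 * (- ta * nu)) -
    (u1 * (si * nu) + v1 * (- ta * nu)) * (u2 * (si * mu) + v2 * (ta * mu)) =
    - (2%:R * (u1 * v2 - v1 * u2) * (si * ta) * (mu * nu)) by ring.
  by rewrite oppr_eq0 !mulf_neq0 // pnatr_eq0.
- by rewrite c40 !mulf_neq0 // mu4 normr_eq0.
- transitivity (co d 4 0 * 4%:R * (si * mu) ^+ 3 * (si * nu) - co d 0 4 * 4%:R * (ta * mu) ^+ 3 * (ta * nu)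
    + 2%:R * mu ^+ 3 * nu * si * ta * (al * si ^+ 2 - ga * ta ^+ 2)).
    by rewrite /al /be /ga /d !co_quartic //=; ring.
  by rewrite d40 d04 e1; ring.
- transitivity (co d 4 0 * 4%:R * (si * nu) ^+ 3 * (si * mu) - co d 0 4 * 4%:R * (ta * nu) ^+ 3 * (ta * mu)
    - 2%:R * nu ^+ 3 * mu * si * ta * (al * si ^+ 2 - ga * ta ^+ 2)).
    by rewrite /al /be /ga /d !co_quartic //=; ring.
  by rewrite d40 d04 e1; ring.
- rewrite c40 c04 mu4 nu4; congr (- _).
  transitivity (si * ta * (B * `|A|)); first ring.
  by rewrite -(same_sign AB); ring.
Qed.
End NormalForm.

Section Structure.
Variable R : realType.

Lemma is_crit_comp_lin (F : fieldType) (c : coefs4 F) p q r s x y : p * s - q * r != 0 ->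
  is_crit (comp_lin c p q r s) x y <-> is_crit c (p * x + q * y) (r * x + s * y).
Proof.
move=> D0; rewrite /is_crit pdx_comp_lin pdy_comp_lin.
set fx := pdx c _ _; set fy := pdy c _ _.
split=> [[e1 e2]|[-> ->]]; last by rewrite !mulr0 addr0.
split; apply: (mulfI D0); rewrite mulr0.
- transitivity (s * (p * fx + r * fy) - r * (q * fx + s * fy)); first ring.
  by rewrite e1 e2 !mulr0 subr0.
- transitivity (p * (q * fx + s * fy) - q * (p * fx + r * fy)); first ring.
  by rewrite e1 e2 !mulr0 subr0.
Qed.

(** Transports [signature_bound] back through the linear change, under which Hessian determinants
    are multiplied by a positive square. Here k is the number of conjugate pairs of non-real
    critical points. *)
Lemma real_crit_structure (c : coefs4 R) : morse4 c -> top_two_real_lines c ->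
  exists s : seq (R * R),
  [/\ uniq s, forall z, z \in s <-> is_crit c z.1 z.2 &
      exists2 k, (size s + k.*2 = 9)%N &
        (count (fun z => 0 < hess_det c z.1 z.2)%R s + k <= 4)%N].
Proof.
move=> [ndg morse] lines.
have [p [q [r [s [D0 c40 c31 c13 c04]]]]] := normal_form ndg lines.
pose c' := comp_lin c p q r s; rewrite -/c' in c40 c31 c13 c04.
pose A : R := 4%:R * co c' 4 0.
have A0 : A != 0 by rewrite mulf_neq0 // pnatr_eq0.
have two0 : 2%:R != 0 :> R by rewrite pnatr_eq0.
have twoC : 2%:R != 0 :> R[i] by rewrite pnatr_eq0.
pose C := cplx c'.
have [C40 C31 C13 C04] : [/\ co C 4 0 != 0, co C 3 1 = 0, co C 1 3 = 0 & co C 0 4 = - co C 4 0].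
  by split; rewrite !co_cplx ?fmorph_eq0 // ?c31 ?c13 ?c04 ?rmorph0 ?rmorphN.
have tauE : ntau C = (ntau c')%:C.
  by rewrite /ntau fmorph_div !rmorphM !rmorph_nat.
have n1E k : ncoef1 C k = (ncoef1 c' k)%:C.
  rewrite /ncoef1 fmorph_div rmorphM rmorph_nat; congr (_ / _).
  by case: k => [|[|[|[|[|[|k]]]]]] /=; rewrite ?nth_nil ?rmorphM ?rmorph_nat ?rmorph0.
have n2E k : ncoef2 C k = (ncoef2 c' k)%:C.
  rewrite /ncoef2 fmorph_div rmorphN rmorphM rmorph_nat; congr (_ / _).
  by case: k => [|[|[|[|[|[|k]]]]]] /=; rewrite ?nth_nil ?rmorphM ?rmorph_nat ?rmorph0.
have bzE x y : bezoutian (ntau c')%:C (fun k => (ncoef1 c' k)%:C) (fun k => (ncoef2 c' k)%:C) x y x y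
    = bezoutian (ntau C) (ncoef1 C) (ncoef2 C) x y x y.
  by rewrite /bezoutian /bez11 /bez12 /bez21 /bez22 tauE !n1E !n2E.
have b1E x y : bcub1 (ntau c')%:C (fun k => (ncoef1 c' k)%:C) x y = bcub1 (ntau C) (ncoef1 C) x y.
  by rewrite /bcub1 tauE !n1E.
have b2E x y : bcub2 (ntau c')%:C (fun k => (ncoef2 c' k)%:C) x y = bcub2 (ntau C) (ncoef2 C) x y.
  by rewrite /bcub2 tauE !n2E.
have AC0 : 4%:R * co C 4 0 != 0 by rewrite mulf_neq0 // pnatr_eq0.
have simple z : bzero (ntau c')%:C (fun k => (ncoef1 c' k)%:C) (fun k => (ncoef2 c' k)%:C) z ->
    bez (ntau c')%:C (fun k => (ncoef1 c' k)%:C) (fun k => (ncoef2 c' k)%:C) z z != 0.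
  rewrite /bzero /bez b1E b2E bzE (bcub1_pdx twoC C40) // (bcub2_pdy twoC C40) //.
  rewrite (bezoutian_hess twoC C40) //.
  rewrite !mulf_eq0 !invr_eq0 oppr_eq0 (negPf AC0) !orbF => /andP[/eqP e1 /eqP e2].
  rewrite oppr_eq0 mulf_eq0 invr_eq0 expf_eq0 (negPf AC0) orbF /=.
  have /(eq_crit (cplx_comp_lin _ _ _ _ _)) : is_crit C z.1 z.2 by [].
  rewrite is_crit_comp_lin; last by rewrite -!rmorphM -rmorphB fmorph_eq0.
  move/morse; rewrite (eq_hess (cplx_comp_lin _ _ _ _ _)) hess_comp_lin mulf_eq0 expf_eq0 /=.
  by rewrite -!rmorphM -rmorphB fmorph_eq0 (negPf D0).
have [s' [us' mems' [k sk ck]]] :=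
  signature_bound (t := ntau c') (a := ncoef1 c') (b := ncoef2 c') simple.
pose L (z : R * R) := (p * z.1 + q * z.2, r * z.1 + s * z.2).
pose L' (z : R * R) := ((s * z.1 - q * z.2) / (p * s - q * r), (p * z.2 - r * z.1) / (p * s - q * r)).
have LK : cancel L L' by move=> [x y]; rewrite /L /L' /=; congr (_, _); field.
have L'K : cancel L' L by move=> [x y]; rewrite /L /L' /=; congr (_, _); field.
have critE z : z \in s' <-> is_crit c' z.1 z.2.
  rewrite mems' (bcub1_pdx two0 c40) // (bcub2_pdy two0 c40) // /is_crit -/A; split=> [[/eqP + /eqP]|[-> ->]].
    by rewrite !mulf_eq0 !invr_eq0 oppr_eq0 (negPf A0) !orbF => /eqP-> /eqP->.
  by rewrite !mul0r.
exists (map L s'); split.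
- by rewrite map_inj_uniq //; apply: can_inj LK.
- move=> z; rewrite -{1}(L'K z) mem_map; last exact: can_inj LK.
  rewrite critE is_crit_comp_lin //.
  by rewrite -[p * _ + _]/(L (L' z)).1 -[r * _ + _]/(L (L' z)).2 L'K.
exists k; first by rewrite size_map.
rewrite count_map; apply: leq_trans ck; rewrite leq_add2r; apply: sub_count => z /=.
rewrite (bezoutian_hess two0 c40) // oppr_lt0 => h; rewrite divr_gt0 // ?exprn_even_gt0 //.
by rewrite hess_comp_lin pmulr_rgt0 // exprn_even_gt0.
Qed.
End Structure.

(** * Local maxima *)

Section LocalMax.
Variable R : realType.
Implicit Types (c : coefs4 R) (z : R * R).

(** The remainder is grouped as h^2 and k^2 times factors that vanish at the origin, so that a
    definite quadratic term can absorb it. *)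
Lemma taylor c x y h k : peval c (x + h) (y + k) =
  peval c x y + (pdx c x y * h + pdy c x y * k)
  + (pdxx c x y * h ^+ 2 + 2%:R * pdxy c x y * h * k + pdyy c x y * k ^+ 2) / 2%:R
  + (h ^+ 2 * ((co c 3 0 + 4%:R * co c 4 0 * x + co c 3 1 * y) * h
               + (co c 2 1 + 3%:R * co c 3 1 * x + 2%:R * co c 2 2 * y) * k
               + co c 4 0 * h ^+ 2 + co c 3 1 * h * k + co c 2 2 * k ^+ 2)
     + k ^+ 2 * ((co c 1 2 + 2%:R * co c 2 2 * x + 3%:R * co c 1 3 * y) * h
                 + (co c 0 3 + co c 1 3 * x + 4%:R * co c 0 4 * y) * k
                 + co c 1 3 * h * k + co c 0 4 * k ^+ 2)).
Proof. by rewrite !pevalE pdxE pdyE pdxxE pdxyE pdyyE; field. Qed.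

Lemma small_pos (K m N e : R) : 0 <= K -> 0 < m -> 0 <= N -> 0 < e ->
  exists s, [/\ 0 < s, s <= 1, s * K < m & s ^+ 2 * N < e].
Proof.
move=> K0 m0 N0 e0; pose D := 1 + K / m + N / e.
have Km : 0 <= K / m by rewrite divr_ge0 // ltW.
have Ne : 0 <= N / e by rewrite divr_ge0 // ltW.
have D1 : 1 <= D by rewrite /D -addrA lerDl addr_ge0.
have D0 : 0 < D by apply: lt_le_trans D1.
have DV1 : D^-1 <= 1 by rewrite invf_le1.
have NE : N < e * D.
  by rewrite -ltr_pdivrMl // mulrC /D; lra.
exists D^-1; split => //; first by rewrite invr_gt0.
  by rewrite mulrC ltr_pdivrMr // -ltr_pdivrMl // mulrC /D; lra.
apply: le_lt_trans (_ : D^-1 * N < _); last by rewrite mulrC ltr_pdivrMr.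
by rewrite expr2 -mulrA ler_piMl // mulr_ge0 // invr_ge0 ltW.
Qed.

Lemma quartic_max (c1 c2 c3 c4 N e : R) : 0 <= N -> 0 < e ->
  (forall s, s ^+ 2 * N < e -> c1 * s + c2 * s ^+ 2 + c3 * s ^+ 3 + c4 * s ^+ 4 <= 0) ->
  c1 = 0 /\ c2 <= 0.
Proof.
move=> N0 e0 H.
have c10 : c1 = 0.
  apply/eqP/negP => /negP c1n.
  have [] := @small_pos (`|c2| + `|c3 * c1| + `|c4 * c1 ^+ 2|) 1 (c1 ^+ 2 * N) e.
  - by rewrite !addr_ge0.
  - by [].
  - by rewrite mulr_ge0 // sqr_ge0.
  - by [].
  move=> s [s0 s1 sK sN]; have := H (s * c1).
  have -> : (s * c1) ^+ 2 * N = s ^+ 2 * (c1 ^+ 2 * N) by ring.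
  move=> /(_ sN).
  have -> : c1 * (s * c1) + c2 * (s * c1) ^+ 2 + c3 * (s * c1) ^+ 3 + c4 * (s * c1) ^+ 4 =
    (s * c1 ^+ 2) * (1 + (s * c2 + s * (s * (c3 * c1)) + s * (s ^+ 2 * (c4 * c1 ^+ 2)))) by ring.
  apply/negP; rewrite -ltNge pmulr_rgt0; last by rewrite pmulr_rgt0 // exprn_even_gt0.
  have b (x : R) : - `|x| <= x by have := ler_norm (- x); rewrite normrN lerNl.
  have b1 : - (s * `|c2|) <= s * c2 by rewrite -mulrN ler_pM2l.
  have b2 : - (s * `|c3 * c1|) <= s * (s * (c3 * c1)).
    rewrite -mulrN ler_pM2l // (le_trans _ (b _)) // lerN2 normrM (gtr0_norm s0).
    by rewrite ler_piMl.
  have b3 : - (s * `|c4 * c1 ^+ 2|) <= s * (s ^+ 2 * (c4 * c1 ^+ 2)).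
    rewrite -mulrN ler_pM2l // (le_trans _ (b _)) // lerN2 normrM ger0_norm ?sqr_ge0 //.
    by rewrite ler_piMl // exprn_ile1 // ltW.
  by move: sK; rewrite !mulrDr => sK; lra.
split => //; rewrite leNgt; apply/negP => c2p.
have [] := @small_pos (`|c3| + `|c4|) c2 N e => //; first by rewrite addr_ge0.
move=> s [s0 s1 sK sN]; have := H s sN; rewrite c10 mul0r add0r.
have -> : c2 * s ^+ 2 + c3 * s ^+ 3 + c4 * s ^+ 4 = s ^+ 2 * (c2 + (s * c3 + s * (s * c4))) by ring.
apply/negP; rewrite -ltNge pmulr_rgt0 ?exprn_even_gt0 ?gt_eqF //.
have b (x : R) : - `|x| <= x by have := ler_norm (- x); rewrite normrN lerNl.
have b1 : - (s * `|c3|) <= s * c3 by rewrite -mulrN ler_pM2l.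
have b2 : - (s * `|c4|) <= s * (s * c4).
  rewrite -mulrN ler_pM2l // (le_trans _ (b _)) // lerN2 normrM (gtr0_norm s0).
  by rewrite ler_piMl.
by move: sK; rewrite !mulrDr => sK; lra.
Qed.

Lemma local_max_necessary c z : local_max c z ->
  [/\ is_crit c z.1 z.2, 0 <= hess_det c z.1 z.2 & pdxx c z.1 z.2 <= 0].
Proof.
case: z => x y [e [e0 /= H]].
have dir u v : pdx c x y * u + pdy c x y * v = 0 /\
    pdxx c x y * u ^+ 2 + 2%:R * pdxy c x y * u * v + pdyy c x y * v ^+ 2 <= 0.
  have [||s sN|h1 h2] := @quartic_max (pdx c x y * u + pdy c x y * v)
    ((pdxx c x y * u ^+ 2 + 2%:R * pdxy c x y * u * v + pdyy c x y * v ^+ 2) / 2%:R)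
    (u ^+ 2 * ((co c 3 0 + 4%:R * co c 4 0 * x + co c 3 1 * y) * u
               + (co c 2 1 + 3%:R * co c 3 1 * x + 2%:R * co c 2 2 * y) * v)
     + v ^+ 2 * ((co c 1 2 + 2%:R * co c 2 2 * x + 3%:R * co c 1 3 * y) * u
                 + (co c 0 3 + co c 1 3 * x + 4%:R * co c 0 4 * y) * v))
    (u ^+ 2 * (co c 4 0 * u ^+ 2 + co c 3 1 * u * v + co c 2 2 * v ^+ 2)
     + v ^+ 2 * (co c 1 3 * u * v + co c 0 4 * v ^+ 2)) (u ^+ 2 + v ^+ 2) e.
  - by rewrite addr_ge0 ?sqr_ge0.
  - by [].
  - have := H (x + s * u, y + s * v); rewrite /= !(addrC _ (s * _)) !addrK !exprMn -mulrDr.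
    move=> /(_ sN); rewrite !(addrC (s * _)) taylor -!addrA gerDl.
    by apply: le_trans; rewrite le_eqVlt; apply/orP; left; apply/eqP; ring.
  - by split => //; lra.
have [e1 _] := dir 1 0; have [e2 _] := dir 0 1.
have dx : pdx c x y = 0 by rewrite -e1; ring.
have dy : pdy c x y = 0 by rewrite -e2; ring.
have [_ q1] := dir 1 0; have [_ q2] := dir 0 1.
have xx : pdxx c x y <= 0 by apply: le_trans q1; rewrite le_eqVlt; apply/orP; left; apply/eqP; ring.
have yy : pdyy c x y <= 0 by apply: le_trans q2; rewrite le_eqVlt; apply/orP; left; apply/eqP; ring.
split => //; rewrite /hess_det.
have [xx0|xx0] := eqVneq (pdxx c x y) 0; last first.
  (* In this direction the quadratic form equals [pdxx] times the Hessian determinant. *)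
  have [_] := dir (pdxy c x y) (- pdxx c x y).
  have -> : pdxx c x y * pdxy c x y ^+ 2 + 2%:R * pdxy c x y * pdxy c x y * - pdxx c x y
      + pdyy c x y * (- pdxx c x y) ^+ 2 = pdxx c x y * (pdxx c x y * pdyy c x y - pdxy c x y ^+ 2).
    by ring.
  by rewrite nmulr_rle0 // lt_neqAle xx0.
have [->|xy0] := eqVneq (pdxy c x y) 0; first by rewrite xx0 mul0r expr0n subr0.
(* With [pdxx] zero the form is affine in the first component, which is chosen to give the value
   1. *)
have [_] := dir ((1 - pdyy c x y) / (2%:R * pdxy c x y)) 1.
have -> : pdxx c x y * ((1 - pdyy c x y) / (2%:R * pdxy c x y)) ^+ 2
    + 2%:R * pdxy c x y * ((1 - pdyy c x y) / (2%:R * pdxy c x y)) * 1 + pdyy c x y * 1 ^+ 2 = 1.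
  by rewrite xx0; field.
by rewrite ler10.
Qed.

Lemma local_max_sufficient c z : is_crit c z.1 z.2 -> 0 < hess_det c z.1 z.2 ->
  pdxx c z.1 z.2 < 0 -> local_max c z.
Proof.
case: z => x y /= [fx fy] hp xx.
set a := pdxx c x y in xx hp *; set d := pdyy c x y in hp; set b := pdxy c x y in hp.
have hp' : 0 < a * d - b ^+ 2 := hp.
have dd : d < 0.
  by rewrite -(nmulr_rgt0 _ xx); apply: lt_le_trans hp' _; rewrite lerBlDr lerDl sqr_ge0.
(* By Cayley-Hamilton H^2 - tr(H) H + det(H) = 0, so the form at v plus [la] |v|^2 equals - |H v|^2
   / (- tr H), which is nonpositive. This gives a definiteness constant without eigenvalues. *)
pose la := (a * d - b ^+ 2) / - (a + d).
have s0 : 0 < - (a + d) by lra.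
have la0 : 0 < la by rewrite divr_gt0.
have form h k : a * h ^+ 2 + 2%:R * b * h * k + d * k ^+ 2 <= - la * (h ^+ 2 + k ^+ 2).
  rewrite -subr_le0.
  have -> : a * h ^+ 2 + 2%:R * b * h * k + d * k ^+ 2 - - la * (h ^+ 2 + k ^+ 2) =
    - ((a * h + b * k) ^+ 2 + (b * h + d * k) ^+ 2) / - (a + d).
    by rewrite /la; field; rewrite ?oppr_eq0; lra.
  by rewrite mulNr oppr_le0 divr_ge0 ?addr_ge0 ?sqr_ge0 ?(ltW s0).
pose r1 := co c 3 0 + 4%:R * co c 4 0 * x + co c 3 1 * y.
pose r2 := co c 2 1 + 3%:R * co c 3 1 * x + 2%:R * co c 2 2 * y.
pose r3 := co c 1 2 + 2%:R * co c 2 2 * x + 3%:R * co c 1 3 * y.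
pose r4 := co c 0 3 + co c 1 3 * x + 4%:R * co c 0 4 * y.
pose K1 := `|r1| + `|r2| + `|co c 4 0| + `|co c 3 1| + `|co c 2 2|.
pose K2 := `|r3| + `|r4| + `|co c 1 3| + `|co c 0 4|.
have K10' : 0 <= K1 by rewrite /K1 !addr_ge0.
have K20' : 0 <= K2 by rewrite /K2 !addr_ge0.
have la2 : 0 < la / 2%:R by rewrite divr_gt0.
have [et [et0 et1 etK _]] := small_pos (addr_ge0 K10' K20') la2 (lexx 0) ltr01.
exists (et ^+ 2); split; first by rewrite exprn_gt0.
move=> [w1 w2] /= small; pose h := w1 - x; pose k := w2 - y.
rewrite -/h -/k in small.
have small' u v : u ^+ 2 + v ^+ 2 < et ^+ 2 -> `|u| <= et.
  move=> uv; rewrite -(@ler_pXn2r _ 2) ?nnegrE ?normr_ge0 ?ltW // -normrX ger0_norm ?sqr_ge0 //.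
  by have := sqr_ge0 v; lra.
have hh := small' h k small.
have kk : `|k| <= et by apply: (small' k h); rewrite addrC.
have -> : w1 = x + h by rewrite /h; ring.
have -> : w2 = y + k by rewrite /k; ring.
rewrite taylor fx fy !mul0r !addr0 -addrA gerDl -/a -/b -/d -/r1 -/r2 -/r3 -/r4.
have ub r u : `|u| <= et -> r * u <= `|r| * et.
  move=> uet; apply: le_trans (ler_norm _) _; rewrite normrM ler_wpM2l //.
have ub2 r u v : `|u| <= et -> `|v| <= et -> r * u * v <= `|r| * et.
  move=> uet vet; apply: le_trans (ler_norm _) _; rewrite !normrM -mulrA ler_wpM2l //.
  by rewrite -[X in _ <= X]mulr1 ler_pM // (le_trans vet).
have p1 : r1 * h + r2 * k + co c 4 0 * h ^+ 2 + co c 3 1 * h * k + co c 2 2 * k ^+ 2 <= et * K1.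
  have := (ub r1 h hh, ub r2 k kk, ub2 (co c 4 0) h h hh hh, ub2 (co c 3 1) h k hh kk,
    ub2 (co c 2 2) k k kk kk); rewrite /K1 -!mulrA -!expr2 => -[[[[]]]] *; lra.
have p2 : r3 * h + r4 * k + co c 1 3 * h * k + co c 0 4 * k ^+ 2 <= et * K2.
  have := (ub r3 h hh, ub r4 k kk, ub2 (co c 1 3) h k hh kk,
    ub2 (co c 0 4) k k kk kk); rewrite /K2 -!mulrA -!expr2 => -[[[]]] *; lra.
have q1 := ler_wpM2l (sqr_ge0 h) p1; have q2 := ler_wpM2l (sqr_ge0 k) p2.
have f := form h k.
have K10 : 0 <= et * K1 by rewrite mulr_ge0 ?(ltW et0).
have K20 : 0 <= et * K2 by rewrite mulr_ge0 ?(ltW et0).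
have q3 : h ^+ 2 * (et * K1) <= h ^+ 2 * (la / 2%:R).
  by rewrite ler_wpM2l ?sqr_ge0 //; move: etK; rewrite mulrDr; lra.
have q4 : k ^+ 2 * (et * K2) <= k ^+ 2 * (la / 2%:R).
  by rewrite ler_wpM2l ?sqr_ge0 //; move: etK; rewrite mulrDr; lra.
lra.
Qed.

Lemma hess_det_cplx c x y : hess_det (cplx c) x%:C y%:C = (hess_det c x y)%:C.
Proof.
rewrite /hess_det !pdxxE !pdyyE !pdxyE /co.
by rewrite !(rmorphB, rmorphD, rmorphM, rmorphXn, rmorph_nat).
Qed.

Lemma pdx_cplx c x y : pdx (cplx c) x%:C y%:C = (pdx c x y)%:C.
Proof. by rewrite !pdxE /co !(rmorphB, rmorphD, rmorphM, rmorphXn, rmorph_nat). Qed.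

Lemma pdy_cplx c x y : pdy (cplx c) x%:C y%:C = (pdy c x y)%:C.
Proof. by rewrite !pdyE /co !(rmorphB, rmorphD, rmorphM, rmorphXn, rmorph_nat). Qed.

Lemma is_crit_cplx c x y : is_crit (cplx c) x%:C y%:C <-> is_crit c x y.
Proof. by rewrite /is_crit pdx_cplx pdy_cplx; split=> [[[->] [->]]|[-> ->]]. Qed.

Lemma morse_hess c x y : morse4 c -> is_crit c x y -> hess_det c x y != 0.
Proof.
by case=> _ H /is_crit_cplx/H; rewrite hess_det_cplx fmorph_eq0.
Qed.

Definition max_type c z := (0 < hess_det c z.1 z.2) && (pdxx c z.1 z.2 < 0).

Lemma local_maxP c z : morse4 c ->
  local_max c z <-> is_crit c z.1 z.2 /\ max_type c z.
Proof.
move=> mc; split=> [/local_max_necessary[cr h xx]|[cr /andP[h xx]]]; last first.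
  exact: local_max_sufficient.
have h0 : 0 < hess_det c z.1 z.2 by rewrite lt_neqAle eq_sym h morse_hess.
split => //; rewrite /max_type h0 lt_neqAle xx andbT /=; apply: contraTneq h0 => x0.
by rewrite /hess_det x0 mul0r sub0r oppr_gt0 -leNgt sqr_ge0.
Qed.

Lemma num_local_max_count c (s : seq (R * R)) : morse4 c -> uniq s ->
  (forall z, z \in s <-> is_crit c z.1 z.2) -> num_local_max c (count (max_type c) s).
Proof.
move=> mc us mems; exists (filter (max_type c) s); split; first exact: filter_uniq.
split; first exact: size_filter.
by move=> z; rewrite local_maxP // mem_filter -mems; split => [/andP[]|[-> ->]].
Qed.

Lemma num_local_max_fun c m n : num_local_max c m -> num_local_max c n -> m = n.
Proof.
move=> [s [us [<- ms]]] [s' [us' [<- ms']]]; apply/perm_size/uniq_perm => // z.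
by apply/idP/idP => [/ms/ms'|/ms'/ms].
Qed.
End LocalMax.

(** * Realization *)

Section Realization.
Variable R : realType.
Implicit Types (c : coefs4 R) (s : seq (R * R)).

Lemma definite_zero (al be ga x y : R) : be ^+ 2 < 4%:R * al * ga ->
  al * x ^+ 2 + be * x * y + ga * y ^+ 2 = 0 -> x = 0 /\ y = 0.
Proof.
move=> disc e.
have al0 : al != 0 by apply: contraTneq disc => ->; rewrite mulr0 mul0r -leNgt sqr_ge0.
have : (2%:R * al * x + be * y) ^+ 2 + (4%:R * al * ga - be ^+ 2) * y ^+ 2 = 0.
  by transitivity (4%:R * al * (al * x ^+ 2 + be * x * y + ga * y ^+ 2)); [ring|rewrite e mulr0].
have p : 0 <= 4%:R * al * ga - be ^+ 2 by rewrite subr_ge0 ltW.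
move/eqP; rewrite paddr_eq0 ?sqr_ge0 ?(mulr_ge0 p) ?sqr_ge0 //.
rewrite sqrf_eq0 mulf_eq0 subr_eq0 (gt_eqF disc) sqrf_eq0 /= => /andP[+ /eqP y0].
by rewrite y0 mulr0 addr0 !mulf_eq0 pnatr_eq0 (negPf al0) => /eqP->.
Qed.

(** The coefficients of (a1 x + b1 y) (a2 x + b2 y) (al x^2 + be x y + ga y^2). *)
Definition top_is c (a1 b1 a2 b2 al be ga : R) :=
  [/\ co c 4 0 = a1 * a2 * al,
      co c 3 1 = (a1 * b2 + b1 * a2) * al + a1 * a2 * be,
      co c 2 2 = b1 * b2 * al + (a1 * b2 + b1 * a2) * be + a1 * a2 * ga,
      co c 1 3 = b1 * b2 * be + (a1 * b2 + b1 * a2) * ga &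
      co c 0 4 = b1 * b2 * ga].

Section Top.
Variables (c : coefs4 R) (a1 b1 a2 b2 al be ga : R).
Hypotheses (D0 : a1 * b2 - a2 * b1 != 0) (disc : be ^+ 2 < 4%:R * al * ga).
Hypothesis top : top_is c a1 b1 a2 b2 al be ga.

Lemma top_two_real_lines_of : top_two_real_lines c.
Proof.
case: top => c40 c31 c22 c13 c04.
exists (- b1, a1), (- b2, a2); split; first by rewrite /= (_ : _ - _ = a1 * b2 - a2 * b1) //; ring.
move=> x y /=.
have -> : ptop c x y = (x * a1 - y * - b1) * (x * a2 - y * - b2)
    * (al * x ^+ 2 + be * x * y + ga * y ^+ 2).
  by rewrite ptopE c40 c31 c22 c13 c04; ring.
split=> [/eqP|[->|->]]; [|by rewrite !mul0r|by rewrite mulr0 mul0r].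
rewrite !mulf_eq0 -orbA => /or3P[/eqP->|/eqP->|/eqP/(definite_zero disc)[-> ->]]; [by left|by right|].
by left; rewrite !mul0r subrr.
Qed.

Lemma nondegenerate_top_of : nondegenerate_top c.
Proof.
case: top => c40 c31 c22 c13 c04.
have al0 : al != 0.
  by apply: contraTneq disc => ->; rewrite mulr0 mul0r -leNgt sqr_ge0.
pose de := Num.sqrt (4%:R * al * ga - be ^+ 2).
have de2 : de ^+ 2 = 4%:R * al * ga - be ^+ 2 by rewrite sqr_sqrtr // subr_ge0 ltW.
have de0 : de != 0 by rewrite sqrtr_eq0 -ltNge subr_gt0.
(* The definite factor splits as (al x + (be + i de)/2 y) (x + (be - i de)/(2 al) y), where de^2 is
   minus its discriminant. *)
pose fa := [:: a1%:C; a2%:C; al%:C; 1].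
pose fb := [:: b1%:C; b2%:C; (be / 2%:R) +i* (de / 2%:R);
               (be / (2%:R * al)) -i* (de / (2%:R * al))].
exists (fun k : 'I_4 => fa`_k), (fun k : 'I_4 => fb`_k); split.
  have n01 : fa`_0 * fb`_1 - fa`_1 * fb`_0 != 0.
    by rewrite /= -!rmorphM -rmorphB fmorph_eq0.
  have real_nz (a b : R) : (a != 0) || (b != 0) ->
      a%:C * fb`_2 - al%:C * b%:C != 0 /\ a%:C * fb`_3 - 1 * b%:C != 0.
    move=> ab; split; apply/eqP => E; move: (congr1 (@complex.Re R) E) (congr1 (@complex.Im R) E);
      rewrite /= => re im.
      have /eqP : a * de = 0 by lra.
      rewrite mulf_eq0 (negPf de0) orbF => /eqP a0; move: ab; rewrite a0 eqxx /=.
      have /eqP : al * b = 0 by rewrite a0 in re; lra.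
      by rewrite mulf_eq0 (negPf al0) /= => ->.
    have d0 : de / (2%:R * al) != 0 by rewrite mulf_neq0 // invr_eq0 mulf_neq0 // pnatr_eq0.
    move: (de / _) (be / _) d0 re im => d' b' d0 re im.
    have /eqP : a * d' = 0 by lra.
    rewrite mulf_eq0 (negPf d0) orbF => /eqP a0; move: ab; rewrite a0 eqxx /=.
    have -> : b = 0 by rewrite a0 in re; lra.
    by rewrite eqxx.
  have ab1 : (a1 != 0) || (b1 != 0).
    by rewrite -negb_and; apply: contraNN D0 => /andP[/eqP-> /eqP->]; rewrite mul0r mulr0 subrr.
  have ab2 : (a2 != 0) || (b2 != 0).
    by rewrite -negb_and; apply: contraNN D0 => /andP[/eqP-> /eqP->]; rewrite mul0r mulr0 subrr.
  have [n02 n03] := real_nz _ _ ab1; have [n12 n13] := real_nz _ _ ab2.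
  have n23 : fa`_2 * fb`_3 - fa`_3 * fb`_2 != 0.
    apply/eqP => /(congr1 (@complex.Im R)) /=.
    rewrite (_ : _ - _ = - de); last by field.
    by move/eqP; rewrite oppr_eq0 (negPf de0).
  case=> [[|[|[|[|k]]]] lk] [[|[|[|[|l]]]] ll] //= _; by [|rewrite -oppr_eq0 opprB].
move=> x y; rewrite ptopE !co_cplx c40 c31 c22 c13 c04 !big_ord_recl big_ord0 /= mulr1.
have q : (al%:C * x + (be / 2%:R +i* (de / 2%:R)) * y) *
    (1 * x + ((be / (2%:R * al)) -i* (de / (2%:R * al))) * y) =
    al%:C * x ^+ 2 + be%:C * x * y + ga%:C * y ^+ 2.
  have -> : be / 2%:R +i* (de / 2%:R) = be%:C / 2%:R + 'i * de%:C / 2%:R.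
    transitivity ((be / 2%:R)%:C + 'i * (de / 2%:R)%:C); first by rewrite [LHS]complexE.
    by rewrite !fmorph_div !rmorph_nat mulrA.
  have -> : (be / (2%:R * al)) -i* (de / (2%:R * al)) =
      (be%:C - 'i * de%:C) / (2%:R * al%:C).
    transitivity ((be / (2%:R * al))%:C + 'i * (- (de / (2%:R * al)))%:C).
      by rewrite [LHS]complexE.
    by rewrite rmorphN !fmorph_div !rmorphM !rmorph_nat; ring.
  have alC : al%:C != 0 by rewrite fmorph_eq0.
  have de2C : de%:C ^+ 2 = 4%:R * al%:C * ga%:C - be%:C ^+ 2.
    by rewrite -rmorphXn de2 !(rmorphB, rmorphM, rmorphXn, rmorph_nat).
  transitivity (al%:C * x ^+ 2 + be%:C * x * y
    + (be%:C ^+ 2 - 'i ^+ 2 * de%:C ^+ 2) / (4%:R * al%:C) * y ^+ 2); first by field.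
  by rewrite sqr_i de2C; field.
rewrite q !(rmorphD, rmorphM); ring.
Qed.
End Top.

Definition min_type c (z : R * R) := (0 < hess_det c z.1 z.2) && (0 < pdxx c z.1 z.2).

(** Minima are recorded beside maxima so that one quartic also serves for its negative. *)
Definition realized (M m n : nat) := exists c s,
  [/\ morse4 c, top_two_real_lines c & uniq s] /\
  [/\ forall z, z \in s <-> is_crit c z.1 z.2, size s = M,
      count (max_type c) s = m & count (min_type c) s = n].

Lemma realizedP M m n : realized M m n -> exists c,
  morse4 c /\ top_two_real_lines c /\ num_real_crit c M /\ num_local_max c m.
Proof.
move=> [c [s [[mc lc us] [ms ss <- _]]]]; exists c; do 2 split => //.
by split; [exists s|apply: num_local_max_count].
Qed.

Definition opp_coefs c : coefs4 R := fun i j => - c i j.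

Lemma realized_opp M m n : realized M m n -> realized M n m.
Proof.
move=> [c [s [[[ndg mc] lc us] [ms ss cm cn]]]]; exists (opp_coefs c), s.
have coN i j : co (opp_coefs c) i j = - co c i j by [].
have coNC i j : co (cplx (opp_coefs c)) i j = - co (cplx c) i j.
  by rewrite !co_cplx coN rmorphN.
have topN x y : ptop (opp_coefs c) x y = - ptop c x y by rewrite !ptopE !coN; ring.
have topNC x y : ptop (cplx (opp_coefs c)) x y = - ptop (cplx c) x y.
  by rewrite !ptopE !coNC; ring.
have crN x y : is_crit (opp_coefs c) x y <-> is_crit c x y.
  have dxN : pdx (opp_coefs c) x y = - pdx c x y by rewrite !pdxE !coN; ring.
  have dyN : pdy (opp_coefs c) x y = - pdy c x y by rewrite !pdyE !coN; ring.
  rewrite /is_crit dxN dyN; split=> [[/eqP + /eqP]|[-> ->]]; last by rewrite oppr0.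
  by rewrite !oppr_eq0 => /eqP-> /eqP->.
have heN x y : hess_det (opp_coefs c) x y = hess_det c x y.
  by rewrite /hess_det !pdxxE !pdyyE !pdxyE !coN; ring.
have xxN x y : pdxx (opp_coefs c) x y = - pdxx c x y.
  by rewrite !pdxxE !coN; ring.
split; split => //.
- split.
    case: ndg => a [b [ab prodE]].
    (* The sign of the product is changed by negating the first linear form only. *)
    exists (fun k => (-1) ^+ (k == ord0) * a k), (fun k => (-1) ^+ (k == ord0) * b k); split.
      move=> k l kl; rewrite mulrACA [X in _ - X]mulrACA [(-1) ^+ (l == _) * _]mulrC -mulrBr.
      by rewrite mulf_neq0 ?ab // -signr_addb signr_eq0.
    move=> x y; rewrite topNC prodE !big_ord_recl !big_ord0 /=; ring.
  move=> x y cr; have -> : hess_det (cplx (opp_coefs c)) x y = hess_det (cplx c) x y.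
    by rewrite /hess_det !pdxxE !pdyyE !pdxyE !coNC; ring.
  apply: mc; case: cr; rewrite /is_crit !pdxE !pdyE !coNC => e1 e2.
  by split; apply/eqP; rewrite -oppr_eq0; apply/eqP; [rewrite -[RHS]e1|rewrite -[RHS]e2]; ring.
- case: lc => u [v [uv H]]; exists u, v; split => // x y; rewrite topN -H.
  by split=> /eqP; rewrite ?oppr_eq0 => /eqP // e; apply/eqP; rewrite oppr_eq0; apply/eqP.
- by move=> z; rewrite ms crN.
- by rewrite -cn; apply: eq_count => z; rewrite /max_type /min_type heN xxN oppr_lt0.
- by rewrite -cm; apply: eq_count => z; rewrite /max_type /min_type heN xxN oppr_gt0.
Qed.
End Realization.

(** For real parameters, a cubic with one visible root a; the sign of k decides whether the other
    two, m plus or minus the square root of k, are real. *)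
Definition cub (F : comPzRingType) (a m k x : F) : F := (x - a) * ((x - m) ^+ 2 - k).
Definition dcub (F : comPzRingType) (a m k x : F) : F :=
  (x - m) ^+ 2 - k + 2%:R * (x - a) * (x - m).

Lemma cub_simple (F : fieldType) (a m k x : F) : 2%:R != 0 :> F -> k != 0 ->
  (a - m) ^+ 2 != k -> cub a m k x = 0 -> dcub a m k x != 0.
Proof.
move=> two0 k0 am /eqP; rewrite /cub mulf_eq0 !subr_eq0 => /orP[/eqP->|/eqP xm].
  by rewrite /dcub subrr mulr0 mul0r addr0 subr_eq0.
rewrite /dcub xm subrr add0r !mulf_neq0 // subr_eq0.
  by apply: contraNneq am => <-; rewrite xm.
by apply: contraNneq k0 => xm0; rewrite -xm xm0 subrr expr0n.
Qed.

(* The quartics g(x) + h(x) y^2 - C y^4, where h = t x^2 + al x + be and g' = 4 cub a m ka. Off the axis y = 0 a critical point has 2 C y^2 = h(x), and x is a critical point of g + h^2 / (4 C), whose derivative is K cub b n la by E0, ..., E3. *)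
Section EvenFamily.
Variable R : realType.
Variables a m ka b n la t al be C K : R.

Definition even_quartic : coefs4 R := quartic
  [:: [:: 0; 0; be; 0; - C]; [:: - 4%:R * a * (m ^+ 2 - ka); 0; al];
      [:: 2%:R * (2%:R * a * m + m ^+ 2 - ka); 0; t];
      [:: - (4%:R / 3%:R * (a + 2%:R * m))]; [:: 1]].
Local Notation c := even_quartic.
Let h x := t * x ^+ 2 + al * x + be.

Hypotheses (C0 : 0 < C) (ka0 : ka != 0) (am : (a - m) ^+ 2 != ka).
Hypotheses (la0 : la != 0) (bn : (b - n) ^+ 2 != la).
Hypotheses (E3 : 8%:R * C + 2%:R * t ^+ 2 = 2%:R * C * K)
  (E2 : - 8%:R * C * (a + 2%:R * m) + 3%:R * t * al = - 2%:R * C * K * (b + 2%:R * n))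
  (E1 : 8%:R * C * (2%:R * a * m + m ^+ 2 - ka) + al ^+ 2 + 2%:R * t * be
        = 2%:R * C * K * (2%:R * b * n + n ^+ 2 - la))
  (E0 : - 8%:R * C * a * (m ^+ 2 - ka) + al * be = - 2%:R * C * K * b * (n ^+ 2 - la)).
(** Excludes h = 0 at a critical point on the axis, where the Hessian determinant, which has the
    factor h there, would vanish. *)
Hypothesis hz : forall x : R[i], t%:C * x ^+ 2 + al%:C * x + be%:C = 0 ->
  cub a%:C m%:C ka%:C x != 0.

Let K0 : 0 < K.
Proof.
have : 0 < 2%:R * C * K by rewrite -E3; apply: ltr_pwDl; [exact: mulr_gt0|rewrite mulr_ge0 ?sqr_ge0].
by rewrite pmulr_rgt0 // mulr_gt0.
Qed.

Lemma even_top : top_two_real_lines c /\ nondegenerate_top c.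
Proof.
(* The top form x^4 + t x^2 y^2 - C y^4 factors as (x^2 - r^2 y^2) (x^2 + (w + t)/2 y^2) with r^2 =
   (w - t)/2. *)
pose w := Num.sqrt (t ^+ 2 + 4%:R * C).
have w2 : w ^+ 2 = t ^+ 2 + 4%:R * C by rewrite sqr_sqrtr // addr_ge0 ?sqr_ge0 // mulr_ge0 // ltW.
have tw : `|t| < w.
  rewrite -(@ltr_pXn2r _ 2) ?nnegrE ?sqrtr_ge0 // -normrX ger0_norm ?sqr_ge0 // w2.
  by rewrite ltrDl mulr_gt0.
have [tw1 tw2] : - w < t /\ t < w by apply/andP; rewrite -ltr_norml.
pose r := Num.sqrt ((w - t) / 2%:R).
have r2 : r ^+ 2 = (w - t) / 2%:R by rewrite sqr_sqrtr //; lra.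
have r0 : 0 < r by rewrite sqrtr_gt0; lra.
have topc : top_is c 1 (- r) 1 r 1 0 ((w + t) / 2%:R).
  split; rewrite co_quartic //=; try ring.
    by transitivity (- r ^+ 2 + (w + t) / 2%:R); [rewrite r2; field|ring].
  transitivity (- (r ^+ 2 * ((w + t) / 2%:R))); last ring.
  transitivity (- ((w ^+ 2 - t ^+ 2) / 4%:R)); first by rewrite w2; field.
  by rewrite r2; field.
have D0 : 1 * r - 1 * - r != 0 :> R by apply: lt0r_neq0; lra.
have disc : 0 ^+ 2 < 4%:R * 1 * ((w + t) / 2%:R) :> R by rewrite expr0n /=; lra.
by split; [apply: top_two_real_lines_of topc|apply: nondegenerate_top_of topc].
Qed.

Section Complex.
Local Notation aC := a%:C. Local Notation mC := m%:C. Local Notation kC := ka%:C.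
Variables x y : R[i].
Let hC := t%:C * x ^+ 2 + al%:C * x + be%:C.
Let dhC := 2%:R * t%:C * x + al%:C.

Let cE : (co (cplx c) 1 0 = - 4%:R * aC * (mC ^+ 2 - kC))
  * (co (cplx c) 2 0 = 2%:R * (2%:R * aC * mC + mC ^+ 2 - kC))
  * (co (cplx c) 3 0 = - (4%:R / 3%:R * (aC + 2%:R * mC))).
Proof.
do !split; rewrite co_cplx co_quartic //=.
- by rewrite !(rmorphM, rmorphB, rmorphN, rmorphXn, rmorph_nat).
- by rewrite !(rmorphM, rmorphB, rmorphD, rmorphN, rmorphXn, rmorph_nat).
- by rewrite rmorphN rmorphM fmorph_div !(rmorphM, rmorphB, rmorphD, rmorphN, rmorphXn, rmorph_nat).
Qed.

Let cE' : (co (cplx c) 0 1 = 0) * (co (cplx c) 1 1 = 0) * (co (cplx c) 2 1 = 0)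
  * (co (cplx c) 3 1 = 0).
Proof. by do !split; rewrite co_cplx co_quartic //= rmorph0. Qed.
Let cE'' : (co (cplx c) 0 3 = 0) * (co (cplx c) 1 3 = 0) * (co (cplx c) 0 4 = - C%:C)
  * (co (cplx c) 4 0 = 1).
Proof. by do !split; rewrite co_cplx co_quartic //= ?rmorph0 ?rmorphN ?rmorph1. Qed.
Let cE3 : (co (cplx c) 0 2 = be%:C) * (co (cplx c) 1 2 = al%:C) * (co (cplx c) 2 2 = t%:C).
Proof. by do !split; rewrite co_cplx co_quartic. Qed.

Let coE := (cE, cE', cE'', cE3).

Let dxE : pdx (cplx c) x y = 4%:R * cub aC mC kC x + dhC * y ^+ 2.
Proof. by rewrite pdxE !coE /cub /dhC; field. Qed.
Let dyE : pdy (cplx c) x y = 2%:R * y * (hC - 2%:R * C%:C * y ^+ 2).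
Proof. by rewrite pdyE !coE /hC; ring. Qed.
Let heE : hess_det (cplx c) x y = (4%:R * dcub aC mC kC x + 2%:R * t%:C * y ^+ 2)
  * (2%:R * hC - 12%:R * C%:C * y ^+ 2) - (2%:R * dhC * y) ^+ 2.
Proof. by rewrite /hess_det pdxxE pdxyE pdyyE !coE /dcub /dhC /hC; field. Qed.

Let lift (u v : R) : u = v -> u%:C = v%:C. Proof. by move->. Qed.
Let push := (rmorphD, rmorphB, rmorphN, rmorphM, rmorphXn, rmorph_nat).

Let cubE : 8%:R * C%:C * cub aC mC kC x + dhC * hC
  = 2%:R * C%:C * K%:C * cub b%:C n%:C la%:C x.
Proof.
move: (lift E3) (lift E2) (lift E1) (lift E0); rewrite !push => e3 e2 e1 e0.
transitivity ((8%:R * C%:C + 2%:R * t%:C ^+ 2) * x ^+ 3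
  + (- 8%:R * C%:C * (aC + 2%:R * mC) + 3%:R * t%:C * al%:C) * x ^+ 2
  + (8%:R * C%:C * (2%:R * aC * mC + mC ^+ 2 - kC) + al%:C ^+ 2 + 2%:R * t%:C * be%:C) * x
  + (- 8%:R * C%:C * aC * (mC ^+ 2 - kC) + al%:C * be%:C)).
  by rewrite /cub /dhC /hC; ring.
by rewrite e3 e2 e1 e0 /cub; ring.
Qed.

Let dcubE : 8%:R * C%:C * dcub aC mC kC x + 2%:R * t%:C * hC + dhC ^+ 2
  = 2%:R * C%:C * K%:C * dcub b%:C n%:C la%:C x.
Proof.
move: (lift E3) (lift E2) (lift E1); rewrite !push => e3 e2 e1.
transitivity (3%:R * (8%:R * C%:C + 2%:R * t%:C ^+ 2) * x ^+ 2
  + 2%:R * (- 8%:R * C%:C * (aC + 2%:R * mC) + 3%:R * t%:C * al%:C) * x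
  + (8%:R * C%:C * (2%:R * aC * mC + mC ^+ 2 - kC) + al%:C ^+ 2 + 2%:R * t%:C * be%:C)).
  by rewrite /dcub /dhC /hC; ring.
by rewrite e3 e2 e1 /dcub; ring.
Qed.

Let two0 : 2%:R != 0 :> R[i]. Proof. by rewrite pnatr_eq0. Qed.
Let CC0 : C%:C != 0. Proof. by rewrite fmorph_eq0 gt_eqF. Qed.

Lemma even_crit : is_crit (cplx c) x y <->
  (y = 0 /\ cub aC mC kC x = 0) \/
  [/\ y != 0, 2%:R * C%:C * y ^+ 2 = hC & cub b%:C n%:C la%:C x = 0].
Proof.
have four0 : 4%:R != 0 :> R[i] by rewrite pnatr_eq0.
rewrite /is_crit dxE dyE; have [->|y0] := eqVneq y 0.
  rewrite expr0n /= !mulr0 mul0r addr0; split=> [[e _]|[[_ ->]|[]]] //; last by rewrite mulr0.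
  by left; split=> //; apply: (mulfI four0); rewrite mulr0.
split=> [[e1 e2]|[[]|[_ e2 e3]]]; last 2 first.
- by move=> e; rewrite e eqxx in y0.
- split; last by rewrite -e2 subrr mulr0.
  have cc0 : 2%:R * C%:C != 0 by rewrite mulf_neq0.
  apply: (mulfI cc0); rewrite mulr0.
  transitivity (8%:R * C%:C * cub aC mC kC x + dhC * (2%:R * C%:C * y ^+ 2)); first by ring.
  by rewrite e2 cubE e3 mulr0.
have e2' : 2%:R * C%:C * y ^+ 2 = hC.
  by move/eqP: e2; rewrite !mulf_eq0 (negPf y0) (negPf two0) subr_eq0 => /eqP.
right; split=> //.
have ck0 : 2%:R * C%:C * K%:C != 0 by rewrite !mulf_neq0 // fmorph_eq0 gt_eqF.
apply: (mulfI ck0); rewrite mulr0 -cubE -e2'.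
transitivity (2%:R * C%:C * (4%:R * cub aC mC kC x + dhC * y ^+ 2)); first by ring.
by rewrite e1 mulr0.
Qed.

Lemma even_hess0 : y = 0 -> hess_det (cplx c) x y = 8%:R * dcub aC mC kC x * hC.
Proof. by move=> y0; rewrite heE y0; ring. Qed.

Lemma even_hess1 : 2%:R * C%:C * y ^+ 2 = hC ->
  hess_det (cplx c) x y = - (4%:R * K%:C * hC * dcub b%:C n%:C la%:C x).
Proof.
move=> e; have cc0 : 2%:R * C%:C != 0 by rewrite mulf_neq0.
apply: (mulfI cc0).
transitivity (- 4%:R * hC * (2%:R * C%:C * K%:C * dcub b%:C n%:C la%:C x)); last by ring.
by rewrite -dcubE heE -e; ring.
Qed.

Lemma even_morse : is_crit (cplx c) x y -> hess_det (cplx c) x y != 0.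
Proof.
have inj u : (u%:C == 0 :> R[i]) = (u == 0) by rewrite fmorph_eq0.
have lt0 := gt_eqF K0; move=> /even_crit[[y0 e]|[y0 e2 e]].
  rewrite (even_hess0 y0) !mulf_neq0 ?pnatr_eq0 //.
    apply: cub_simple e; rewrite ?inj //.
    by rewrite -rmorphB -rmorphXn (inj_eq (@complexI R)).
  by apply: contraTneq isT => /hz; rewrite e eqxx.
rewrite (even_hess1 e2) oppr_eq0 !mulf_neq0 ?pnatr_eq0 ?inj ?lt0 //.
  by rewrite -e2 !mulf_neq0 // expf_neq0.
apply: cub_simple e; rewrite ?inj //.
by rewrite -rmorphB -rmorphXn (inj_eq (@complexI R)).
Qed.
End Complex.

Lemma morse_even : morse4 c.
Proof. by split; [case: even_top|apply: even_morse]. Qed.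

Variables (ra rb : seq R).
Hypotheses (ura : uniq ra) (urb : uniq rb).
Hypothesis mra : forall x, (x \in ra) = (cub a m ka x == 0).
Hypothesis mrb : forall x, (x \in rb) = (cub b n la x == 0).

Lemma even_crit_real x y : is_crit c x y <->
  (y = 0 /\ x \in ra) \/ [/\ y != 0, 2%:R * C * y ^+ 2 = h x & x \in rb].
Proof.
have cubC u v w : cub u%:C v%:C w%:C x%:C = (cub u v w x)%:C.
  by rewrite /cub !(rmorphM, rmorphB, rmorphXn).
have hE : t%:C * x%:C ^+ 2 + al%:C * x%:C + be%:C = (h x)%:C.
  by rewrite /h !(rmorphD, rmorphM, rmorphXn).
have yE : 2%:R * C%:C * y%:C ^+ 2 = (2%:R * C * y ^+ 2)%:C.
  by rewrite !(rmorphM, rmorphXn, rmorph_nat).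
rewrite -is_crit_cplx even_crit !cubC hE yE fmorph_eq0 mra mrb.
split=> [[[[y0] [e]]|[y0 [e2] [e]]]|[[-> /eqP->]|[y0 -> /eqP->]]].
- by left; rewrite e.
- by right; rewrite e.
- by left.
- by right.
Qed.

Definition rbp := [seq x <- rb | 0 < h x].
Definition hgt x := Num.sqrt (h x / (2%:R * C)).

Definition even_list : seq (R * R) :=
  [seq (x, 0) | x <- ra] ++ [seq (x, hgt x) | x <- rbp] ++ [seq (x, - hgt x) | x <- rbp].

Let C20 : 0 < 2%:R * C. Proof. exact: mulr_gt0. Qed.

Let hgt_gt0 x : x \in rbp -> 0 < hgt x.
Proof. by rewrite mem_filter => /andP[hx _]; rewrite sqrtr_gt0 divr_gt0. Qed.

Let hgt2 x : x \in rbp -> 2%:R * C * hgt x ^+ 2 = h x.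
Proof.
rewrite mem_filter => /andP[hx _]; rewrite sqr_sqrtr ?divr_ge0 ?ltW //.
by rewrite mulrCA mulfV ?mulr1 // gt_eqF.
Qed.

Lemma mem_even_list z : z \in even_list <-> is_crit c z.1 z.2.
Proof.
case: z => x y; rewrite even_crit_real !mem_cat; split.
  case/or3P => /mapP[u ur [-> ->]] /=; first by left.
    right; rewrite gt_eqF ?hgt_gt0 // hgt2 //; split=> //.
    by move: ur; rewrite mem_filter => /andP[].
  right; rewrite oppr_eq0 gt_eqF ?hgt_gt0 // sqrrN hgt2 //; split=> //.
  by move: ur; rewrite mem_filter => /andP[].
case=> /= [[-> xr]|[y0 e xr]]; first by rewrite map_f.
have xp : x \in rbp.
  by rewrite mem_filter xr -e andbT pmulr_rgt0 // exprn_even_gt0.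
have /eqP : y ^+ 2 = hgt x ^+ 2.
  by apply: (mulfI (lt0r_neq0 C20)); rewrite e hgt2.
by rewrite eqf_sqr => /orP[/eqP->|/eqP->]; rewrite map_f ?orbT.
Qed.

Lemma uniq_even_list : uniq even_list.
Proof.
have up : uniq rbp by rewrite filter_uniq.
rewrite /even_list !cat_uniq !map_inj_uniq ?ura ?up /=; try by move=> u v [].
rewrite andbT; apply/andP; split; apply/hasPn => -[x y].
  rewrite mem_cat => /orP[] /mapP[u ur [-> ->]]; apply/negP => /mapP[v _ [_ /eqP]].
    by rewrite gt_eqF ?hgt_gt0.
  by rewrite oppr_eq0 gt_eqF ?hgt_gt0.
move=> /mapP[u ur [-> ->]]; apply/negP => /mapP[v vr [uv /eqP]].
by rewrite -uv in vr *; rewrite lt_eqF // (lt_trans _ (hgt_gt0 ur)) // oppr_lt0 hgt_gt0.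
Qed.

Let pdxx0 x : pdxx c x 0 = 4%:R * dcub a m ka x.
Proof. by rewrite pdxxE !co_quartic //= /dcub; field. Qed.

Let hess0 x : hess_det c x 0 = 8%:R * dcub a m ka x * h x.
Proof.
apply: (@complexI R); rewrite -hess_det_cplx even_hess0 ?rmorph0 // /dcub /h.
by rewrite !(rmorph_nat, rmorphXn, rmorphN, rmorphM, rmorphB, rmorphD).
Qed.

Let hess1 x y : 2%:R * C * y ^+ 2 = h x -> hess_det c x y = - (4%:R * K * h x * dcub b n la x).
Proof.
move=> e; apply: (@complexI R); rewrite -hess_det_cplx even_hess1 /dcub.
  by rewrite /h !(rmorph_nat, rmorphXn, rmorphN, rmorphM, rmorphB, rmorphD).
move/(congr1 (fun u : R => u%:C)): e.
by rewrite /h !(rmorph_nat, rmorphXn, rmorphN, rmorphM, rmorphB, rmorphD).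
Qed.

Let pdyy1 x y : 2%:R * C * y ^+ 2 = h x -> pdyy c x y = - (4%:R * h x).
Proof.
move=> e; transitivity (2%:R * h x - 6%:R * (2%:R * C * y ^+ 2)).
  by rewrite pdyyE !co_quartic //= /h; ring.
by rewrite e; ring.
Qed.

(** Off the axis [pdyy] is - 4 h < 0, so an extremum there can only be a maximum. *)
Let type1 x y : 0 < h x -> 2%:R * C * y ^+ 2 = h x ->
  (max_type c (x, y) = (dcub b n la x < 0)) * (min_type c (x, y) = false).
Proof.
move=> hx e; have hd : (0 < hess_det c x y) = (dcub b n la x < 0).
  by rewrite (hess1 e) oppr_gt0 pmulr_rlt0 // !mulr_gt0.
have xx : 0 < hess_det c x y -> pdxx c x y < 0.
  rewrite /hess_det (pdyy1 e) subr_gt0 => /(le_lt_trans (sqr_ge0 _)).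
  by rewrite mulrN oppr_gt0 pmulr_llt0 // mulr_gt0.
rewrite /max_type /min_type /= -hd; case: (ltP 0 (hess_det c x y)) => // /xx lt0.
by rewrite lt0 (lt_gtF lt0).
Qed.

(** On the axis the Hessian matrix is diagonal with entries 4 [dcub] and 2 h; off it, points come in
    mirror pairs, one pair for each root of the second cubic at which h is positive. *)
Lemma even_realized : realized R (size ra + (size rbp).*2)
  (count (fun x => (h x < 0) && (dcub a m ka x < 0)) ra
   + (count (fun x => dcub b n la x < 0) rbp).*2)
  (count (fun x => (0 < h x) && (0 < dcub a m ka x)) ra).
Proof.
have ct (P : pred (R * R)) : count P even_list =
    (count (fun x => P (x, 0%R)) ra + (count (fun x => P (x, hgt x)) rbp
     + count (fun x => P (x, - hgt x)%R) rbp))%N.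
  by rewrite /even_list !count_cat !count_map.
have tp x : x \in rbp -> forall y, y ^+ 2 = hgt x ^+ 2 ->
    (max_type c (x, y) = (dcub b n la x < 0)) * (min_type c (x, y) = false).
  move=> xr y e; apply: type1; first by move: xr; rewrite mem_filter => /andP[].
  by rewrite e hgt2.
have p4 : 0 < 4%:R :> R by rewrite ltr0n.
have p8 : 0 < 8%:R :> R by rewrite ltr0n.
exists c, even_list; split; split.
- exact: morse_even.
- by case: even_top.
- exact: uniq_even_list.
- exact: mem_even_list.
- by rewrite /even_list !size_cat !size_map addnn.
- rewrite ct -addnn; congr (_ + (_ + _))%N.
  + apply: eq_count => x; rewrite /max_type /= hess0 pdxx0 (pmulr_rlt0 _ p4) -mulrA (pmulr_rgt0 _ p8).
    have [d0|d0|->] := ltrgtP (dcub a m ka x) 0; rewrite ?andbF ?andbT //.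
    by rewrite nmulr_rgt0.
  + by apply: eq_in_count => x xr; rewrite tp.
  + by apply: eq_in_count => x xr; rewrite tp // sqrrN.
- rewrite ct [X in (_ + X)%N](_ : _ = 0%N) ?addn0.
    apply: eq_count => x; rewrite /min_type /= hess0 pdxx0 -mulrA (pmulr_rgt0 _ p8) (pmulr_rgt0 _ p4).
    have [d0|d0|->] := ltrgtP (dcub a m ka x) 0; rewrite ?andbF ?andbT //.
    by rewrite pmulr_rgt0.
  have z (f : R -> R) : (forall x, f x ^+ 2 = hgt x ^+ 2) ->
      count (fun x => min_type c (x, f x)) rbp = 0%N.
    move=> f2; rewrite (@eq_in_count _ _ pred0) ?count_pred0 // => x xr.
    by rewrite tp.
  by rewrite !z // => x; rewrite sqrrN.
Qed.
End EvenFamily.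

(** * Explicit parameters for the even family *)

Section Examples.
Variable R : realType.

Lemma cub_roots3 (a m k : R) : [:: a; m - k; m + k] =i [pred x | cub a m (k ^+ 2) x == 0].
Proof.
move=> x; rewrite !inE /cub mulf_eq0 subr_eq0; congr (_ || _).
by rewrite subr_eq0 eqf_sqr subr_eq subr_eq [- k + m]addrC [k + m]addrC orbC.
Qed.

Lemma cub_roots1 (a m ka x : R) : ka < 0 -> (x \in [:: a]) = (cub a m ka x == 0).
Proof.
move=> ka0; rewrite !inE /cub mulf_eq0 subr_eq0 [X in _ || X]gt_eqF ?orbF //.
by rewrite subr_gt0 (lt_le_trans ka0) // sqr_ge0.
Qed.

Let cubC (a m k x : R) : (cub a%:C m%:C k%:C x%:C == 0) = (cub a m k x == 0).
Proof. by rewrite -(fmorph_eq0 (real_complex R)) /cub !(rmorphXn, rmorphM, rmorphB). Qed.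

Lemma const_hz (be a m ka : R) : be != 0 -> forall x : R[i],
  0%:C * x ^+ 2 + 0%:C * x + be%:C = 0 -> cub a%:C m%:C ka%:C x != 0.
Proof. by move=> be0 x /eqP; rewrite !mul0r !add0r fmorph_eq0 (negPf be0). Qed.

Lemma linear_hz (be a m ka : R) : cub a m ka (- be) != 0 -> forall x : R[i],
  0%:C * x ^+ 2 + 1%:C * x + be%:C = 0 -> cub a%:C m%:C ka%:C x != 0.
Proof.
move=> h x /eqP; rewrite mul0r add0r mul1r addr_eq0 => /eqP->.
by rewrite -rmorphN cubC.
Qed.

Lemma realized_eq M m n M' m' n' : realized R M m n -> M = M' -> m = m' -> n = n' ->
  realized R M' m' n'.
Proof. by move=> H <- <- <-. Qed.

Ltac neq := apply/negP => /eqP ?; lra.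
Ltac count_signs :=
  rewrite ?/rbp ?/dcub /=;
  repeat (let H := fresh in case: ltrP => H /=; try (exfalso; lra)); by [].

Let roots3 (a m k ka : R) x : ka = k ^+ 2 ->
  (x \in [:: a; m - k; m + k]) = (cub a m ka x == 0).
Proof. by move->; rewrite cub_roots3. Qed.

Let uniq3 (a m k : R) : 0 < k -> a != m - k -> a != m + k -> uniq [:: a; m - k; m + k].
Proof.
by move=> k0 h1 h2; rewrite /= !inE negb_or h1 h2 !andbT; apply/negP => /eqP ?; lra.
Qed.

(** With h constant the variables separate, g(x) + be y^2 - y^4, and the two cubics coincide; this
    also covers the next two examples. *)
Lemma realized_1_0 : realized R 1 0 0.
Proof.
apply: (realized_eq (@even_realized R 0 0 (-1) 0 0 (-1) 0 0 (-1) 1 4%:R _ _ _ _ _ _ _ _ _ _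
  [:: 0] [:: 0] _ _ _ _)) => //; try neq; try ring; try count_signs.
- by apply: const_hz; neq.
- by move=> x; apply: cub_roots1; lra.
- by move=> x; apply: cub_roots1; lra.
Qed.

Lemma realized_3_1 : realized R 3 1 0.
Proof.
apply: (realized_eq (@even_realized R 0 0 1 0 0 1 0 0 (-1) 1 4%:R _ _ _ _ _ _ _ _ _ _
  [:: 0; 0 - 1; 0 + 1] [:: 0; 0 - 1; 0 + 1] _ _ _ _)) => //;
  try neq; try ring; try count_signs.
- by apply: const_hz; neq.
- by apply: uniq3; try neq; lra.
- by apply: uniq3; try neq; lra.
- by move=> x; apply: roots3; ring.
- by move=> x; apply: roots3; ring.
Qed.

Lemma realized_9_2 : realized R 9 2 2.
Proof.
apply: (realized_eq (@even_realized R 0 0 1 0 0 1 0 0 1 1 4%:R _ _ _ _ _ _ _ _ _ _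
  [:: 0; 0 - 1; 0 + 1] [:: 0; 0 - 1; 0 + 1] _ _ _ _)) => //;
  try neq; try ring; try count_signs.
- by apply: const_hz; neq.
- by apply: uniq3; try neq; lra.
- by apply: uniq3; try neq; lra.
- by move=> x; apply: roots3; ring.
- by move=> x; apply: roots3; ring.
Qed.

(** For h = x + be, C = 1/8 and K = 4 the conditions say that the second cubic is the first plus h.
    Here x^3 - 2 x - 4 becomes x^3 - x; the next two examples turn x^3 - x into x^3 + 8 and x^3 -
    1/8. *)
Lemma realized_7_2 : realized R 7 2 1.
Proof.
apply: (realized_eq (@even_realized R 2%:R (-1) (-1) 0 0 1 0 1 4%:R (1 / 8%:R) 4%:R
  _ _ _ _ _ _ _ _ _ _ [:: 2%:R] [:: 0; 0 - 1; 0 + 1] _ _ _ _)) => //;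
  try neq; try field; try count_signs; try lra.
- by apply: linear_hz; rewrite /cub; neq.
- by apply: uniq3; try neq; lra.
- by move=> x; apply: cub_roots1; lra.
- by move=> x; apply: roots3; ring.
Qed.

Lemma realized_5_0 : realized R 5 0 2.
Proof.
apply: (realized_eq (@even_realized R 0 0 1 (- 2%:R) 1 (- 3%:R) 0 1 8%:R (1 / 8%:R) 4%:R
  _ _ _ _ _ _ _ _ _ _ [:: 0; 0 - 1; 0 + 1] [:: - 2%:R] _ _ _ _)) => //;
  try neq; try field; try count_signs; try lra.
- by apply: linear_hz; rewrite /cub; neq.
- by apply: uniq3; try neq; lra.
- by move=> x; apply: roots3; ring.
- by move=> x; apply: cub_roots1; lra.
Qed.

Lemma realized_5_1 : realized R 5 1 1.
Proof.
apply: (realized_eq (@even_realized R 0 0 1 (1 / 2%:R) (- 1 / 4%:R) (- 3%:R / 16%:R) 0 1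
  (- 1 / 8%:R) (1 / 8%:R) 4%:R
  _ _ _ _ _ _ _ _ _ _ [:: 0; 0 - 1; 0 + 1] [:: 1 / 2%:R] _ _ _ _)) => //;
  try neq; try field; try count_signs; try lra.
- by apply: linear_hz; rewrite /cub; neq.
- by apply: uniq3; try neq; lra.
- by move=> x; apply: roots3; ring.
- by move=> x; apply: cub_roots1; lra.
Qed.

(** The cubics (x + 2) (x + 1) (x - 6) and x (x - 1) (x - 2) differ by 18 h with h = x + 2/3, and 18
    = 1 / (8 C). The maxima are the pair over x = 1 and the axis point x = -1. *)
Lemma realized_9_3 : realized R 9 3 1.
Proof.
apply: (realized_eq (@even_realized R 6%:R (- 3%:R / 2%:R) (1 / 4%:R) 0 (3%:R / 2%:R) (1 / 4%:R)
  0 1 (2%:R / 3%:R) (1 / 144%:R) 4%:R _ _ _ _ _ _ _ _ _ _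
  [:: 6%:R; - 3%:R / 2%:R - 1 / 2%:R; - 3%:R / 2%:R + 1 / 2%:R]
  [:: 0; 3%:R / 2%:R - 1 / 2%:R; 3%:R / 2%:R + 1 / 2%:R] _ _ _ _)) => //;
  try neq; try field; try count_signs; try lra.
- by apply: linear_hz; rewrite /cub; neq.
- by apply: uniq3; try neq; lra.
- by apply: uniq3; try neq; lra.
- by move=> x; apply: roots3; field.
- by move=> x; apply: roots3; field.
Qed.

(** Here h = 2 - 2 x^2 is negative at all axis roots -3, -15/8, -9/5, so no minimum arises, and
    positive at the off-axis roots 1/3 and 5/9 but not at -81/80. The maxima are the pair over 1/3
    and the axis point -15/8. *)
Lemma realized_7_3 : realized R 7 3 0.
Proof.
apply: (realized_eq (@even_realized R (- 15%:R / 8%:R) (- 12%:R / 5%:R) (9%:R / 25%:R)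
  (- 81%:R / 80%:R) (4%:R / 9%:R) (1 / 81%:R)
  (- 2%:R) 0 2%:R (1 / 53%:R) 216%:R _ _ _ _ _ _ _ _ _ _
  [:: - 15%:R / 8%:R; - 12%:R / 5%:R - 3%:R / 5%:R; - 12%:R / 5%:R + 3%:R / 5%:R]
  [:: - 81%:R / 80%:R; 4%:R / 9%:R - 1 / 9%:R; 4%:R / 9%:R + 1 / 9%:R] _ _ _ _)) => //;
  try neq; try field; try count_signs; try lra.
- move=> x h.
  have /eqP : x ^+ 2 = 1 ^+ 2.
    apply: (mulfI (_ : 2%:R != 0)); first by rewrite pnatr_eq0.
    apply/eqP; rewrite -subr_eq0 -oppr_eq0 -[X in _ == X]h; apply/eqP.
    by rewrite rmorphN rmorph0 rmorph_nat; ring.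
  rewrite eqf_sqr -(rmorph1 (real_complex R)) -rmorphN => /orP[] /eqP-> {h};
    rewrite cubC /cub; neq.
- by apply: uniq3; try neq; lra.
- by apply: uniq3; try neq; lra.
- by move=> x; apply: roots3; field.
- by move=> x; apply: roots3; field.
Qed.
End Examples.

(* The critical points (0, 0), (2, 0), (0, 1), (4, -3) are four local maxima; the top form is the product of x - 2 y, x - y and a definite form. *)
Section FourMaxima.

Definition quartic94 (F : comPzRingType) : coefs4 F := quartic
  [:: [:: 0; 0; - 93%:R; 190%:R; - 96%:R]; [:: 0; 396%:R; - 306%:R; - 90%:R];
      [:: - 504%:R; - 396%:R; 159%:R]; [:: 360%:R; 99%:R]; [:: - 72%:R]].

Let co94 (F : comPzRingType) : (co (quartic94 F) 0 1 = 0) * (co (quartic94 F) 0 2 = - 93%:R)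
  * (co (quartic94 F) 0 3 = 190%:R) * (co (quartic94 F) 0 4 = - 96%:R)
  * (co (quartic94 F) 1 0 = 0) * (co (quartic94 F) 1 1 = 396%:R)
  * (co (quartic94 F) 1 2 = - 306%:R) * (co (quartic94 F) 1 3 = - 90%:R)
  * (co (quartic94 F) 2 0 = - 504%:R) * (co (quartic94 F) 2 1 = - 396%:R)
  * (co (quartic94 F) 2 2 = 159%:R) * (co (quartic94 F) 3 0 = 360%:R)
  * (co (quartic94 F) 3 1 = 99%:R) * (co (quartic94 F) 4 0 = - 72%:R).
Proof. by do !split; rewrite co_quartic. Qed.

Let lincomb_eq0 (F : comPzRingType) (u v w p q h : F) :
  p = 0 -> q = 0 -> h = 0 -> u * p + v * q + w * h = 0.
Proof. by move=> -> -> ->; rewrite !mulr0 !addr0. Qed.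

(* A Nullstellensatz certificate, found by linear algebra, that no critical point is degenerate. It is stated over an abstract ring because the large literals must not be unfolded in R[i]. *)
Definition cert94 (F : comPzRingType) : F :=
  1%:R * 10%:R ^+ 54 + 59%:R * 10%:R ^+ 51 + 104%:R * 10%:R ^+ 48
    + 571%:R * 10%:R ^+ 45 + 217%:R * 10%:R ^+ 42 + 107%:R * 10%:R ^+ 39
    + 23%:R * 10%:R ^+ 36 + 359%:R * 10%:R ^+ 33 + 911%:R * 10%:R ^+ 30
    + 130%:R * 10%:R ^+ 27 + 94%:R * 10%:R ^+ 24 + 14%:R * 10%:R ^+ 21
    + 813%:R * 10%:R ^+ 18 + 852%:R * 10%:R ^+ 15 + 706%:R * 10%:R ^+ 12
    + 364%:R * 10%:R ^+ 9 + 864%:R * 10%:R ^+ 6 + 566%:R * 10%:R ^+ 3 + 400%:R.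

(** Writing the 55-digit integer in base 1000 makes positivity a matter of small positive terms. *)
Let cert94_gt0 (K : numDomainType) : 0 < cert94 K.
Proof. by rewrite /cert94 !addr_gt0 ?mulr_gt0 ?exprn_gt0 ?ltr0n. Qed.

Lemma quartic94_certificate (F : comPzRingType) (x y : F) :
  is_crit (quartic94 F) x y -> hess_det (quartic94 F) x y = 0 ->
  cert94 F = 0.
Proof.
rewrite /is_crit /hess_det pdxE pdyE pdxxE pdxyE pdyyE !co94 => -[].
set p := (X in X = 0); set q := (X in _ -> X = 0 -> _) => p0 q0.
set h := (X in X = 0) => h0.
rewrite /cert94; transitivity (
  (898438172543846927480426886824652905779105167045797100%:R
    - 6318367010993852494369353598321865516372624417953422168%:R * y
    + 11779807029844110924384097533270928029997765654668143172%:R * y ^+ 2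
    + 2799372289868495613642782357099081512331268749402582850%:R * y ^+ 3
    - 33323192389738520591601482336952124465350810977222918610%:R * y ^+ 4
    + 22046749781015196915013605230813204241122130468366647160%:R * y ^+ 5
    + 283240989750728436256025497028531988951448973234396508%:R * x
    - 4116195348364443582470758880971137529453862353291992648%:R * x * y
    + 2822484751970866415644411931401121132152376165907469764%:R * x * y ^+ 2
    + 9061798218473262936206243874424216097033851084368417378%:R * x * y ^+ 3
    + 27160498014808715379665040045170283357761565298638740640%:R * x * y ^+ 4
    - 358151703842153314490983997842074466036440423996459804%:R * x ^+ 2
    + 3323037152632123136727442873668177829618305574824373581%:R * x ^+ 2 * y
    - 1892529872289013052458328018216286054838231537653038499%:R * x ^+ 2 * y ^+ 2
    - 1177007014865291112904541652668394356893641375577741260%:R * x ^+ 2 * y ^+ 3) * p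
  + (2212752006249961352033552654972009867850946619864425800%:R
    - 15882031763543210177939540198070453666438947862965804892%:R * y
    - 122474198113700571155011584834081855465304754424323808%:R * y ^+ 2
    + 43254288760713153578547323537793111904048558397551901910%:R * y ^+ 3
    - 8035289581654084610076565970092980640584597685761249918%:R * y ^+ 4
    - 13580249007404357689832520022585141678880782649319370320%:R * y ^+ 5
    + 667894015669672679485348925012882101329078152727086784%:R * x
    + 10125058087532345321466252762729375525577889655877687044%:R * x * y
    - 31786616196685428847917374029747376722578274126859555862%:R * x * y ^+ 2
    - 72243776688240277022416893248635091581294468858636309938%:R * x * y ^+ 3
    + 2354014029730582225809083305336788713787282751155482520%:R * x * y ^+ 4
    - 1007494657454649777001089924302856074390354154598159998%:R * x ^+ 2
    - 552108764966115321867262008941625016576157008103523000%:R * x ^+ 2 * y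
    + 17069518663562061885678813202467718921555659299346904761%:R * x ^+ 2 * y ^+ 2
    + 26284192991576410233574418765847986072577274476558058620%:R * x ^+ 2 * y ^+ 3) * q
  + (34530013406921851309334609092788693722375663956200%:R
    + 2401081275688000299799618881799318251511664400073500%:R * y
    - 6457070144826440717097390085867230305824289981901297%:R * y ^+ 2
    - 3315100555839250068488549546315516604551420192435223%:R * y ^+ 3
    + 7355062286679383362348403177106398434985358201936180%:R * y ^+ 4
    + 9383155817098329160145274209996927641949908683750%:R * x
    - 2787333811868759674572095862920964212604416312914248%:R * x * y
    + 6157496124685241350421122314217214954299279959773691%:R * x * y ^+ 2
    + 8103110599891636990311288137809429101116976450212660%:R * x * y ^+ 3) * h);
  first by rewrite /p /q /h; ring.
exact: lincomb_eq0.
Qed.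

Variable R : realType.
Local Notation quartic94R := (quartic94 R).

Let cplx94 : cplx quartic94R =2 quartic94 R[i].
Proof.
move=> i j; have [li lj] := (ltn_ord i, ltn_ord j).
rewrite /cplx /quartic94 /quartic; case: i j li lj => [i _] [j _] /= li lj.
do 5 (case: i li => [_|i li]; [
do 5 (case: j lj => [_|j lj]; [by rewrite /= ?rmorphN ?rmorph_nat ?rmorph0|]); by []|]); by [].
Qed.

Lemma quartic94_top : top_is quartic94R 1 (- 2%:R) 1 (- 1) (- 72%:R) (- 117%:R) (- 48%:R).
Proof. by split; rewrite co94; ring. Qed.

Lemma morse_quartic94 : morse4 quartic94R /\ top_two_real_lines quartic94R.
Proof.
have D0 : 1 * - 1 - 1 * - 2%:R != 0 :> R by apply/negP => /eqP ?; lra.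
have disc : (- 117%:R) ^+ 2 < 4%:R * - 72%:R * - 48%:R :> R by lra.
split; last exact: top_two_real_lines_of quartic94_top.
split; first exact: nondegenerate_top_of quartic94_top.
move=> x y /(eq_crit cplx94) cr; rewrite (eq_hess cplx94); apply/eqP => h.
by have := cert94_gt0 R[i]; rewrite (quartic94_certificate cr h) ltxx.
Qed.

Let max4 : seq (R * R) := [:: (0, 0); (2%:R, 0); (0, 1); (4%:R, - 3%:R)].

Let max4P z : z \in max4 -> is_crit quartic94R z.1 z.2 /\ max_type quartic94R z.
Proof.
rewrite !inE => /or4P[] /eqP->; rewrite /is_crit /max_type /hess_det /=
  pdxE pdyE pdxxE pdyyE pdxyE !co94; (split; [split; ring|apply/andP; split; lra]).
Qed.

Let uniq_max4 : uniq max4.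
Proof.
rewrite /max4 /= !inE !xpair_eqE !negb_or.
by do !(apply/andP; split) => //; apply/negP => /andP[/eqP e1 /eqP e2]; move: e1 e2 => *; lra.
Qed.

(** The other critical points are never computed: four maxima saturate the bound 4 - k, which forces
    k = 0, hence nine real critical points, no further maximum and no minimum. *)
Lemma realized_9_4 : realized R 9 4 0.
Proof.
have [mc lc] := morse_quartic94.
have [s [us ms [k sk ck]]] := real_crit_structure mc lc.
have sub4 : {subset max4 <= filter (max_type quartic94R) s}.
  by move=> z /max4P[/ms zs zm]; rewrite mem_filter zm zs.
have le4 : (4 <= count (max_type quartic94R) s)%N.
  by rewrite -size_filter; apply: (uniq_leq_size uniq_max4 sub4).
have le : (count (max_type quartic94R) s <= count (fun z => 0 < hess_det quartic94R z.1 z.2)%R s)%N.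
  by apply: sub_count => z /andP[].
have k0 : k = 0%N.
  by apply/eqP; rewrite -leqn0 -(leq_add2l 4) addn0 (leq_trans _ ck) // leq_add2r (leq_trans le4).
rewrite k0 double0 !addn0 in sk ck.
have c4 : count (max_type quartic94R) s = 4%N.
  by apply/eqP; rewrite eqn_leq le4 (leq_trans le).
exists quartic94R, s; split; split => //.
have : (count (max_type quartic94R) s + count (min_type quartic94R) s <= 4)%N.
  apply: leq_trans ck; rewrite -count_predUI [X in (_ + X)%N](@eq_count _ _ pred0) ?count_pred0 ?addn0.
    by apply: sub_count => z /orP[] /andP[].
  by move=> z /=; apply/negP => /andP[/andP[_ h1] /andP[_ h2]]; have := lt_trans h1 h2; rewrite ltxx.
by rewrite c4 -[X in (_ <= X)%N]addn0 leq_add2l leqn0 => /eqP.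
Qed.
End FourMaxima.

Local Close Scope complex_scope.

Lemma realized_all (R : realType) (M m : nat) :
  M \in [:: 1; 3; 5; 7; 9]%N -> (m.*2 < M)%N -> exists n, realized R M m n.
Proof.
have opp := @realized_opp R.
rewrite !inE => /or4P[|||/orP[]] /eqP->.
- by case: m => [|m] // _; exists 0%N; apply: realized_1_0.
- case: m => [|[|m]] // _; eexists; [apply/opp|]; exact: realized_3_1.
- case: m => [|[|[|m]]] // _; eexists.
  + exact: realized_5_0.
  + exact: realized_5_1.
  + exact/opp/realized_5_0.
- case: m => [|[|[|[|m]]]] // _; eexists.
  + exact/opp/realized_7_3.
  + exact/opp/realized_7_2.
  + exact: realized_7_2.
  + exact: realized_7_3.
- case: m => [|[|[|[|[|m]]]]] // _; eexists.
  + exact/opp/realized_9_4.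
  + exact/opp/realized_9_3.
  + exact: realized_9_2.
  + exact: realized_9_3.
  + exact: realized_9_4.
Qed.

Theorem theorem2 (R : realType) (M mp : nat) :
  (exists c : coefs4 R,
      morse4 c /\ top_two_real_lines c /\
      num_real_crit c M /\ num_local_max c mp)
  <-> (M \in [:: 1; 3; 5; 7; 9]%N /\ (mp.*2 < M)%N).
Proof.
split=> [[c [mc [lc [[s [us [<- ms]]] nm]]]]|[HM Hm]]; last first.
  by have [n /realizedP] := realized_all R HM Hm.
have [s' [us' ms' [k sk ck]]] := real_crit_structure mc lc.
have -> : size s = size s'.
  apply/perm_size/uniq_perm => // z.
  by apply/idP/idP => [/ms/ms'|/ms'/ms].
have lt : (mp.*2 < size s')%N.
  have -> := num_local_max_fun nm (num_local_max_count mc us' ms').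
  have le : (count (max_type c) s' <= count (fun z => 0 < hess_det c z.1 z.2)%R s')%N.
    by apply: sub_count => z /andP[].
  (* After adding 2 k to both sides the right one is 9, while twice the bound of
     [real_crit_structure] is 8. *)
  rewrite -(ltn_add2r k.*2) sk -doubleD ltnS (leq_trans _ (_ : 4.*2 <= 8)%N) // leq_double.
  by apply: leq_trans ck; rewrite leq_add2r.
split => //; have sE : size s' = (9 - k.*2)%N by rewrite -sk addnK.
have : (k <= 4)%N by apply: leq_trans ck; apply: leq_addl.
by rewrite sE; case: k {sk ck sE} => [|[|[|[|[|k]]]]].
Qed.
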